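(* The Heyting algebra of the Turing–Weihrauch degrees of partial multimaps on multi-represented spaces (the LT-degrees) is isomorphic to the poset of $r$-degrees of Lawvere–Tierney topologies on $\Omega$.
   Context: Let $(\mathsf N,\mathbf N,\ast)$ be one of: (i) Kleene's first algebra: $\mathsf N=\mathbf N=\mathbb N$, $e\ast n=\varphi_e(n)$ for the standard indexing of partial computable functions on $\mathbb N$; (ii) Kleene's second algebra: $\mathsf N=\mathbf N=\mathbb N^{\mathbb N}$, $x\ast y=\varphi_x(y)$ for the standard indexing $(\varphi_x)_{x\in\mathbb N^{\mathbb N}}$ of partial continuous functions on Baire space (e.g. $(x\ast y)(n)=x(\langle n,y(0),\dots,y(k-1)\rangle)-1$ for the least $k$ making $x(\cdots)>0$; $x\ast y$ is defined iff such $k$ exists for all $n$); (iii) the Kleene–Vesley algebra: $\mathbf N=\mathbb N^{\mathbb N}$ with $\ast$ as in (ii) and $\mathsf N$ the set of computable elements of $\mathbb N^{\mathbb N}$. A partial function on $\mathbf N$ is computable if for some $e\in\mathsf N$ it agrees with $x\mapsto e\ast x$ on its domain. Pairs and finite sequences of elements of $\mathbf N$ are coded in $\mathbf N$ in a standard computable way. A multi-represented space is a set $X$ with a relation $\mathtt x\vdash_X x$ (''$\mathtt x$ is a name of $x$'') between $\mathbf N$ and $X$ such that every $x\in X$ has at least one name (one $\mathtt x$ may name several points). A partial multimap $f$ from $X$ to $Y$ is a partial function from $X$ to $\mathcal P(Y)$ (the value $\emptyset$ is allowed). An extended predicate is a partial function $F$ from $\mathbf N\times\Lambda$ to $\mathcal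 P(\mathbf N)$, $\Lambda$ a set; write $F(\mathtt x\mid x)$ for $F(\mathtt x,x)$. A partial multimap $f$ from $X$ to $Y$ between multi-represented spaces is regarded as the extended predicate $\theta_f$ with $\Lambda=X$, $\mathrm{dom}(\theta_f)=\{(\mathtt x\mid x):\mathtt x\vdash_X x\in\mathrm{dom}(f)\}$ and $\theta_f(\mathtt x\mid x)=\{\mathtt y:\exists y\in f(x)\;\mathtt y\vdash_Y y\}$. LT-reducibility. For extended predicates $F,G$ consider the game $\mathfrak G(F,G)$ between Merlin, Arthur and Nimue. Merlin first plays a pair $(\mathtt p_0\mid x_0)\in\mathrm{dom}(F)$. At round $n\ge 0$ Arthur plays $\langle A_n,\mathtt q_n\rangle$ with $A_n\in\{\mathtt{Query},\mathtt{Halt}\}$, $\mathtt q_n\in\mathbf N$. If $A_n=\mathtt{Halt}$ the game terminates. If $A_n=\mathtt{Query}$, Nimue must play $z_n$ with $(\mathtt q_n\mid z_n)\in\mathrm{dom}(G)$, and then Merlin must answer with some $\mathtt p_{n+1}\in G(\mathtt q_n\mid z_n)$. Arthur and Nimue win if Merlin violates the rules before Arthur or Nimue does, or if both obey the rules and at some round Arthur halts with $\mathtt q_n\in F(\mathtt p_0\mid x_0)$ (an infinite rule-obeying play is not won by them). Arthur sees only $\mathtt p_0,\mathtt p_1,\dots$: his strategy is a partial map $\tau$ from $\mathbf N^{<\omega}$ to $\{\mathtt{Query},\mathtt{Halt}\}\times\mathbf N$ with $\langle A_n,\mathtt q_n\rangle=\tau(\mathtt p_0,\dots,\mathtt p_n)$.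 Nimue and Merlin see all moves; Nimue's strategy is an arbitrary partial function $\eta$ with $z_n=\eta(x_0,\mathtt p_0,\mathtt q_0,\dots,\mathtt p_n,\mathtt q_n)$, and Merlin's strategies are arbitrary. Undefined moves count as rule violations. A pair $(\tau\mid\eta)$ is winning if Arthur and Nimue win every play in which they follow it; it is computable if $\tau$ is computable. $F\leq_{LT}G$ iff there is a computable winning pair $(\tau\mid\eta)$ for $\mathfrak G(F,G)$. For partial multimaps $f,g$ on multi-represented spaces, $f$ is Turing–Weihrauch reducible to $g$ iff $\theta_f\leq_{LT}\theta_g$. $\Omega=\mathcal P(\mathbf N)$. For $p,q\in\Omega$, $p\to q=\{x\in\mathbf N: x\ast a\text{ is defined and }x\ast a\in q\text{ for all }a\in p\}$. An operation $j\colon\Omega\to\Omega$ is a Lawvere–Tierney topology if each of the following holds: some $e\in\mathsf N$ belongs to $(p\to q)\to(j(p)\to j(q))$ for all $p,q\in\Omega$; some $e\in\mathsf N$ belongs to $p\to j(p)$ for all $p\in\Omega$; some $e\in\mathsf N$ belongs to $j(j(p))\to j(p)$ for all $p\in\Omega$. $j\leq_r k$ iff some $e\in\mathsf N$ belongs to $j(p)\to k(p)$ for all $p\in\Omega$. Degrees are equivalence classes of the preorder, with the induced partial order; the Heyting structure is the one determined by the order, and isomorphism means order isomorphism. *)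

(* Defs.v *)
From Stdlib Require Import Arith List Cantor FinFun Relations.
Import ListNotations.

(** * Partial computable functions on [nat] *)

(* Unary mu-recursive functions; several arguments are packed with the Cantor
   pairing [Cantor.to_nat]. *)
Inductive code : Set :=
| c_zero | c_succ | c_left | c_right
| c_pair (f g : code)
| c_comp (f g : code)
| c_prec (f g : code)
| c_mu (f : code).

(* [eval c n m]: the partial function denoted by [c] is defined at [n] with
   value [m]. *)
Fixpoint eval (c : code) (n m : nat) {struct c} : Prop :=
  match c with
  | c_zero => m = 0
  | c_succ => m = S n
  | c_left => m = fst (Cantor.of_nat n)
  | c_right => m = snd (Cantor.of_nat n)
  | c_pair f g =>
      exists a b, eval f n a /\ eval g n b /\ m = Cantor.to_nat (a, b)
  | c_comp f g => exists a, eval g n a /\ eval f a m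
  | c_prec f g =>
      let (a, k) := Cantor.of_nat n in
      (fix rec (i r : nat) {struct i} : Prop :=
         match i with
         | 0 => eval f a r
         | S i' => exists s, rec i' s
             /\ eval g (Cantor.to_nat (a, Cantor.to_nat (i', s))) r
         end) k m
  | c_mu f =>
      eval f (Cantor.to_nat (n, m)) 0
      /\ forall i, i < m -> exists r, eval f (Cantor.to_nat (n, i)) (S r)
  end.

Fixpoint godel (c : code) : nat :=
  match c with
  | c_zero => Cantor.to_nat (0, 0)
  | c_succ => Cantor.to_nat (1, 0)
  | c_left => Cantor.to_nat (2, 0)
  | c_right => Cantor.to_nat (3, 0)
  | c_pair f g => Cantor.to_nat (4, Cantor.to_nat (godel f, godel g))
  | c_comp f g => Cantor.to_nat (5, Cantor.to_nat (godel f, godel g))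
  | c_prec f g => Cantor.to_nat (6, Cantor.to_nat (godel f, godel g))
  | c_mu f => Cantor.to_nat (7, godel f)
  end.

(* The graph of [phi_e]; an index that is not a Goedel number denotes the
   nowhere defined function. *)
Definition phi (e n m : nat) : Prop := exists c, godel c = e /\ eval c n m.

Definition computable_seq (x : nat -> nat) : Prop :=
  exists e, forall n, phi e n (x n).

(** * The three algebras *)

Fixpoint seq_code (l : list nat) : nat :=
  match l with
  | [] => 0
  | a :: l' => S (Cantor.to_nat (a, seq_code l'))
  end.

(* Kleene's second application, as the graph of a partial operation: [k] is the
   least number with [x <n, y 0, ..., y (k-1)> > 0]. *)
Definition k2_app (x y z : nat -> nat) : Prop :=
  forall n, exists k,
    x (seq_code (n :: map y (seq 0 k))) = S (z n)
    /\ forall i, i < k -> x (seq_code (n :: map y (seq 0 i))) = 0.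

Definition interleave (x y : nat -> nat) (n : nat) : nat :=
  if Nat.even n then x (Nat.div2 n) else y (Nat.div2 n).

(* [carrier] is the boldface N, [comp] its lightface subset, and [appl x y z]
   says that [x * y] is defined and equal to [z].  [npair] and [num] fix the
   coding of pairs and of numerals. *)
Record algebra : Type := Algebra {
  carrier :> Type;
  comp : carrier -> Prop;
  appl : carrier -> carrier -> carrier -> Prop;
  npair : carrier -> carrier -> carrier;
  num : nat -> carrier
}.
Arguments comp {a}.
Arguments appl {a}.
Arguments npair {a}.
Arguments num {a}.

Definition K1 : algebra :=
  Algebra nat (fun _ => True) phi (fun a b => Cantor.to_nat (a, b)) (fun n => n).

Definition K2 : algebra :=
  Algebra (nat -> nat) (fun _ => True) k2_app interleave (fun n _ => n).

Definition KV : algebra :=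
  Algebra (nat -> nat) computable_seq k2_app interleave (fun n _ => n).

Fixpoint list_code {A : algebra} (l : list A) : A :=
  match l with
  | [] => npair (num 0) (num 0)
  | a :: l' => npair (num 1) (npair a (list_code l'))
  end.

(** * Multi-represented spaces, partial multimaps, extended predicates *)

Record mrspace (A : algebra) : Type := MRSpace {
  point :> Type;
  names : A -> point -> Prop;
  named : forall x, exists a, names a x
}.
Arguments names {A}.

(* Partial functions into power sets are given by a domain and a value; the
   value outside the domain is never consulted. *)
Record multimap {A : algebra} (X Y : mrspace A) : Type := Multimap {
  mm_dom : X -> Prop;
  mm_val : X -> Y -> Prop
}.
Arguments mm_dom {A X Y}.
Arguments mm_val {A X Y}.

Record ext_pred (A : algebra) (L : Type) : Type := ExtPred {
  ep_dom : A -> L -> Prop;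
  ep_val : A -> L -> A -> Prop
}.
Arguments ExtPred {A L}.
Arguments ep_dom {A L}.
Arguments ep_val {A L}.

Definition theta {A : algebra} {X Y : mrspace A} (f : multimap X Y)
  : ext_pred A X :=
  ExtPred (fun a x => names X a x /\ mm_dom f x)
          (fun _ x b => exists y, mm_val f x y /\ names Y b y).

(** * The game *)

Inductive action : Set := Query | Halt.

Definition move_code {A : algebra} (m : action * A) : A :=
  match m with
  | (Query, q) => npair (num 0) q
  | (Halt, q) => npair (num 1) q
  end.

Section Game.
Context {A : algebra} {L M : Type} (F : ext_pred A L) (G : ext_pred A M).

(* [None] is an undefined move.  Entries after the end of the game are
   irrelevant.  A Merlin who makes no move loses exactly when an illegal answer
   would lose, so his answers form a total sequence [merlin 0, merlin 1, ...];
   his opening move is [(merlin 0 | opening)]. *)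
Record play : Type := Play {
  opening : L;
  merlin : nat -> A;
  arthur : nat -> option (action * A);
  nimue : nat -> option M
}.

Definition legal_query (P : play) (n : nat) (q : A) (z : M) : Prop :=
  arthur P n = Some (Query, q) /\ nimue P n = Some z /\ ep_dom G q z.

Definition round_continues (P : play) (n : nat) : Prop :=
  exists q z, legal_query P n q z /\ ep_val G q z (merlin P (S n)).

Definition merlin_violates (P : play) (n : nat) : Prop :=
  exists q z, legal_query P n q z /\ ~ ep_val G q z (merlin P (S n)).

Definition halts_correctly (P : play) (n : nat) : Prop :=
  exists q, arthur P n = Some (Halt, q) /\ ep_val F (merlin P 0) (opening P) q.

Definition won (P : play) : Prop :=
  ~ ep_dom F (merlin P 0) (opening P)
  \/ exists n, (forall i, i < n -> round_continues P i)
       /\ (halts_correctly P n \/ merlin_violates P n).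

Definition arthur_strategy : Type := list A -> option (action * A).

(* The list holds [(p_0, q_0), ..., (p_n, q_n)]. *)
Definition nimue_strategy : Type := L -> list (A * A) -> option M.

Definition follows (tau : arthur_strategy) (eta : nimue_strategy) (P : play)
  : Prop :=
  forall n,
    arthur P n = tau (map (merlin P) (seq 0 (S n)))
    /\ forall qs : nat -> A,
         (forall i, i <= n -> exists a, arthur P i = Some (a, qs i)) ->
         nimue P n
         = eta (opening P) (map (fun i => (merlin P i, qs i)) (seq 0 (S n))).

Definition winning (tau : arthur_strategy) (eta : nimue_strategy) : Prop :=
  forall P, follows tau eta P -> won P.

Definition computable_strategy (tau : arthur_strategy) : Prop :=
  exists e : A, comp e
    /\ forall l m, tau l = Some m -> appl e (list_code l) (move_code m).

Definition LT_le : Prop :=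
  exists tau eta, computable_strategy tau /\ winning tau eta.

End Game.

(** * Preorders and their degrees *)

Definition degree {T : Type} (le : T -> T -> Prop) : Type :=
  { C : T -> Prop | exists x, forall y, C y <-> le x y /\ le y x }.

Definition degree_le {T : Type} (le : T -> T -> Prop) (C D : degree le) : Prop :=
  exists x y, proj1_sig C x /\ proj1_sig D y /\ le x y.

Definition is_meet {T : Type} (le : T -> T -> Prop) (x y m : T) : Prop :=
  forall z, le z m <-> le z x /\ le z y.

Definition is_join {T : Type} (le : T -> T -> Prop) (x y s : T) : Prop :=
  forall z, le s z <-> le x z /\ le y z.

Record is_heyting {T : Type} (le : T -> T -> Prop) : Prop := {
  heyting_order : order T le;
  heyting_bot : exists b, forall x, le b x;
  heyting_top : exists t, forall x, le x t;
  heyting_meet : forall x y, exists m, is_meet le x y m;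
  heyting_join : forall x y, exists s, is_join le x y s;
  heyting_imp : forall x y, exists i,
    forall z m, is_meet le z x m -> (le z i <-> le m y)
}.

Definition order_isomorphic {S T : Type}
  (leS : S -> S -> Prop) (leT : T -> T -> Prop) : Prop :=
  exists h : S -> T, Bijective h /\ forall x y, leS x y <-> leT (h x) (h y).

(** * Turing-Weihrauch reducibility *)

Record problem (A : algebra) : Type := Problem {
  source : mrspace A;
  target : mrspace A;
  the_map : multimap source target
}.
Arguments the_map {A}.

Definition TW_le (A : algebra) (f g : problem A) : Prop :=
  LT_le (theta (the_map f)) (theta (the_map g)).

(** * Lawvere-Tierney topologies *)

Definition Omega (A : algebra) : Type := A -> Prop.

Definition imp {A : algebra} (p q : Omega A) : Omega A :=
  fun x => forall a, p a -> exists b, appl x a b /\ q b.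

Record is_LT {A : algebra} (j : Omega A -> Omega A) : Prop := {
  LT_mono : exists e, comp e /\ forall p q, imp (imp p q) (imp (j p) (j q)) e;
  LT_unit : exists e, comp e /\ forall p, imp p (j p) e;
  LT_mult : exists e, comp e /\ forall p, imp (j (j p)) (j p) e
}.

Definition topology (A : algebra) : Type :=
  { j : Omega A -> Omega A | is_LT j }.

Definition r_le (A : algebra) (j k : topology A) : Prop :=
  exists e, comp e /\ forall p, imp (proj1_sig j p) (proj1_sig k p) e.

(* Main.v *)
Require Import Defs.
From Stdlib Require Import Arith List Cantor Relations Lia.
From Stdlib Require Import Classical ClassicalEpsilon FunctionalExtensionality PropExtensionality.
Import ListNotations.

(* The topology attached to an extended predicate [G] sends [p] to the set
   [tree G p] of codes of Arthur's strategies, well-founded under some play of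
   Nimue, that end in [p].  It is the least topology [j] for which some
   computable [e] sends every instance of [G] to a realizer of [j] of its
   solution set, and such an [e] for [j = tree H] is the same thing as a
   computable winning pair: hence [LT_le F G] iff [tree F <=_r tree G].  A
   topology [j] comes from the multimap "given a realizer of [j p], find an
   element of [p]", [p] being a point of a multi-represented space.
   The Heyting implication of topologies is
   [(j => k) p = /\_q ((p -> q) -> (j q -> k q))].
   What remains is that the three algebras are combinatory complete, with
   computable combinators. *)

(** * Recursive functions *)

(** Three features of the game shape [tree]. Arthur never sees the secret point, so a continuation
    depends on the answer alone while the point is quantified existentially at each node; Nimue need
    not be computable, so she leaves no trace in the code; an infinite play is lost, so the
    predicate is inductive. Passing from a winning pair to a tree is a classical argument, and
    passing back takes choice to collect Nimue's moves. A tree consumes one answer at a time,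
    Arthur's strategy a whole history; each direction converts by a recursion inside the algebra.
    The points of the problem attached to [j] are only the [p] with [j p] inhabited, because points
    must have names; a reduction speaks of no other [p]. On Baire space a combinator must be
    continuous and, for [KV], computable. Finite approximations with fuel serve both ends:
    convergence gives the defining equation, and the approximators are built from recursive
    operations. The recurring obstacle is totality: a curried function must be defined even where
    its eventual result is not. *)

Definition cp (a b : nat) : nat := Cantor.to_nat (a, b).
Definition pi1 (n : nat) : nat := fst (Cantor.of_nat n).
Definition pi2 (n : nat) : nat := snd (Cantor.of_nat n).

Lemma pi1_cp a b : pi1 (cp a b) = a.
Proof. unfold pi1, cp. now rewrite Cantor.cancel_of_to. Qed.

Lemma pi2_cp a b : pi2 (cp a b) = b.
Proof. unfold pi2, cp. now rewrite Cantor.cancel_of_to. Qed.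

Lemma cp_pi n : cp (pi1 n) (pi2 n) = n.
Proof.
  unfold cp, pi1, pi2. rewrite <- surjective_pairing. apply Cantor.cancel_to_of.
Qed.

Lemma cp_inj a b a' b' : cp a b = cp a' b' -> a = a' /\ b = b'.
Proof.
  intros E. split.
  - rewrite <- (pi1_cp a b), E. apply pi1_cp.
  - rewrite <- (pi2_cp a b), E. apply pi2_cp.
Qed.

Definition recursive (f : nat -> nat) : Prop := exists c, forall n, eval c n (f n).
Definition recursive2 (f : nat -> nat -> nat) : Prop :=
  recursive (fun w => f (pi1 w) (pi2 w)).

Lemma recursive_id : recursive (fun w => w).
Proof.
  exists (c_pair c_left c_right). intros n. exists (pi1 n), (pi2 n).
  repeat split. symmetry. apply cp_pi.
Qed.

Lemma recursive_comp f g :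
  recursive f -> recursive g -> recursive (fun w => f (g w)).
Proof. intros [c Hc] [d Hd]. exists (c_comp c d). intros n. exists (g n). auto. Qed.

Lemma recursive_S f : recursive f -> recursive (fun w => S (f w)).
Proof. apply recursive_comp. exists c_succ. reflexivity. Qed.

Lemma recursive_pi1 f : recursive f -> recursive (fun w => pi1 (f w)).
Proof. apply (recursive_comp pi1). exists c_left. reflexivity. Qed.

Lemma recursive_pi2 f : recursive f -> recursive (fun w => pi2 (f w)).
Proof. apply (recursive_comp pi2). exists c_right. reflexivity. Qed.

Lemma recursive_cp f g :
  recursive f -> recursive g -> recursive (fun w => cp (f w) (g w)).
Proof.
  intros [c Hc] [d Hd]. exists (c_pair c d). intros n. exists (f n), (g n).
  repeat split; auto.
Qed.

Fixpoint const_code (n : nat) : code :=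
  match n with 0 => c_zero | S n' => c_comp c_succ (const_code n') end.

Lemma eval_const_code n m : eval (const_code n) m n.
Proof. induction n; cbn; eauto. Qed.

Lemma recursive_const n : recursive (fun _ => n).
Proof. exists (const_code n). apply eval_const_code. Qed.

Lemma eval_prec cb cs a k (h : nat -> nat) :
  eval cb a (h 0) ->
  (forall i, i < k -> eval cs (cp a (cp i (h i))) (h (S i))) ->
  eval (c_prec cb cs) (cp a k) (h k).
Proof.
  intros H0 HS. unfold cp. cbn [eval]. rewrite Cantor.cancel_of_to.
  induction k as [|k IH]; [exact H0|].
  exists (h k). split; [apply IH; intros; apply HS; lia | apply HS; lia].
Qed.

(** [c_prec] hands its parameter on to every round, so with [w] itself as parameter the step [s] may
    depend on [w]. *)
Lemma recursive_rec b s k :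
  recursive b -> recursive k ->
  recursive (fun w => s (pi1 w) (pi1 (pi2 w)) (pi2 (pi2 w))) ->
  recursive (fun w => nat_rect (fun _ => nat) (b w) (s w) (k w)).
Proof.
  intros [cb Hb] Hk [cs Hs].
  destruct (recursive_cp _ _ recursive_id Hk) as [ck Hck].
  exists (c_comp (c_prec cb cs) ck). intros n. exists (cp n (k n)). split; [apply Hck|].
  apply (eval_prec cb cs n (k n) (nat_rect (fun _ => nat) (b n) (s n))); [apply Hb|].
  intros i _. specialize (Hs (cp n (cp i (nat_rect (fun _ => nat) (b n) (s n) i)))).
  rewrite !pi2_cp, !pi1_cp in Hs. exact Hs.
Qed.

Lemma recursive_iter f b k :
  recursive f -> recursive b -> recursive k ->
  recursive (fun w => Nat.iter (k w) f (b w)).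
Proof.
  intros Hf Hb Hk.
  apply (recursive_rec b (fun _ _ r => f r) k Hb Hk).
  apply recursive_comp; [exact Hf|]. apply recursive_pi2, recursive_pi2, recursive_id.
Qed.

Lemma recursive2_app f g h :
  recursive2 f -> recursive g -> recursive h -> recursive (fun w => f (g w) (h w)).
Proof.
  intros Hf Hg Hh.
  destruct (recursive_comp _ _ Hf (recursive_cp _ _ Hg Hh)) as [c Hc].
  exists c. intros n. specialize (Hc n). cbv beta in Hc.
  rewrite pi1_cp, pi2_cp in Hc. exact Hc.
Qed.

Definition ifz (c a b : nat) : nat := match c with 0 => a | S _ => b end.

Lemma recursive_ifz c a b :
  recursive c -> recursive a -> recursive b ->
  recursive (fun w => ifz (c w) (a w) (b w)).
Proof.
  intros Hc Ha Hb.
  destruct (recursive_rec a (fun w _ _ => b w) c Ha Hc) as [d Hd].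
  - apply recursive_comp; [exact Hb|]. apply recursive_pi1, recursive_id.
  - exists d. intros n. specialize (Hd n). cbv beta in Hd.
    destruct (c n); exact Hd.
Qed.

Lemma recursive_pred f : recursive f -> recursive (fun w => pred (f w)).
Proof.
  apply (recursive_comp pred).
  destruct (recursive_rec (fun _ => 0) (fun _ i _ => i) (fun w => w)) as [d Hd].
  - apply recursive_const.
  - apply recursive_id.
  - apply recursive_pi1, recursive_pi2, recursive_id.
  - exists d. intros n. specialize (Hd n). cbv beta in Hd.
    destruct n; exact Hd.
Qed.

Lemma recursive_sub f g :
  recursive f -> recursive g -> recursive (fun w => f w - g w).
Proof.
  intros Hf Hg.
  destruct (recursive_rec f (fun _ _ r => pred r) g Hf Hg) as [d Hd].
  - apply recursive_pred, recursive_pi2, recursive_pi2, recursive_id.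
  - exists d. intros n. specialize (Hd n). cbv beta in Hd.
    replace (f n - g n) with (nat_rect (fun _ => nat) (f n) (fun _ r => pred r) (g n));
      [exact Hd|].
    clear. induction (g n) as [|k IH]; cbn [nat_rect]; lia.
Qed.

Lemma recursive_ext f g : (forall n, f n = g n) -> recursive f -> recursive g.
Proof. intros E [c Hc]. exists c. intros n. rewrite <- E. apply Hc. Qed.

Lemma recursive_double f : recursive f -> recursive (fun w => 2 * f w).
Proof.
  intros Hf. eapply recursive_ext; [|apply (recursive_rec (fun _ => 0)
    (fun _ _ r => S (S r)) f)];
    [|apply recursive_const|exact Hf|apply recursive_S, recursive_S, recursive_pi2, recursive_pi2, recursive_id].
  intros w. cbv beta. induction (f w) as [|k IHk]; [reflexivity|].
  cbn [nat_rect]. rewrite IHk. lia.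
Qed.

Ltac recursive_step :=
  lazymatch goal with
  | |- recursive (fun _ => ?c) => apply recursive_const
  | |- recursive (fun w => w) => apply recursive_id
  | |- recursive pi1 => exact (recursive_pi1 _ recursive_id)
  | |- recursive pi2 => exact (recursive_pi2 _ recursive_id)
  | |- recursive S => exact (recursive_S _ recursive_id)
  | |- recursive pred => exact (recursive_pred _ recursive_id)
  | |- recursive (fun w => S _) => apply recursive_S
  | |- recursive (fun w => pred _) => apply recursive_pred
  | |- recursive (fun w => pi1 _) => apply recursive_pi1
  | |- recursive (fun w => pi2 _) => apply recursive_pi2
  | |- recursive (fun w => cp _ _) => apply recursive_cp
  | |- recursive (fun w => ifz _ _ _) => apply recursive_ifz
  | |- recursive (fun w => 2 * _) => apply recursive_double
  | |- recursive (fun w => _ - _) => apply recursive_sub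
  | H : recursive ?f |- recursive (fun w => ?f _) => apply (recursive_comp f _ H)
  | H : recursive2 ?f |- recursive (fun w => ?f _ _) => apply (recursive2_app f _ _ H)
  | |- recursive2 _ => unfold recursive2
  | |- recursive _ => assumption
  end.
Ltac recursive := repeat recursive_step; try assumption.

Lemma recursive_mu f (g : nat -> nat) :
  recursive2 f ->
  (forall n, f n (g n) = 0 /\ forall i, i < g n -> f n i <> 0) ->
  recursive g.
Proof.
  intros [c Hc] Hg. exists (c_mu c). intros n. destruct (Hg n) as [H0 Hlt]. split.
  - specialize (Hc (cp n (g n))). cbv beta in Hc.
    rewrite pi1_cp, pi2_cp, H0 in Hc. exact Hc.
  - intros i Hi. exists (pred (f n i)). specialize (Hc (cp n i)). cbv beta in Hc.
    rewrite pi1_cp, pi2_cp in Hc.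
    replace (S (pred (f n i))) with (f n i) by (specialize (Hlt i Hi); lia). exact Hc.
Qed.

Lemma least_witness (P : nat -> Prop) n :
  P n -> exists m, m <= n /\ P m /\ forall i, i < m -> ~ P i.
Proof.
  induction n as [n IH] using lt_wf_ind. intros Hn.
  destruct (classic (exists i, i < n /\ P i)) as [[i [Hi Pi]]|Hno].
  - destruct (IH i Hi Pi) as [m [Hm HP]]. exists m. split; [lia|exact HP].
  - exists n. split; [lia|]. split; [exact Hn|]. intros i Hi Pi. apply Hno. eauto.
Qed.

Lemma godel_inj c d : godel c = godel d -> c = d.
Proof.
  revert d.
  induction c; destruct d; cbn [godel]; fold cp; intros E;
    apply cp_inj in E as [E1 E]; try discriminate E1; try reflexivity;
    try (apply cp_inj in E as [E2 E]); f_equal; auto.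
Qed.

Lemma eval_det c : forall n m m', eval c n m -> eval c n m' -> m = m'.
Proof.
  induction c as [| | | |f IHf g IHg|f IHf g IHg|f IHf g IHg|f IHf]; cbn [eval];
    intros n m m' H H'; try congruence.
  - destruct H as (a & b & Ha & Hb & ->), H' as (a' & b' & Ha' & Hb' & ->).
    now rewrite (IHf _ _ _ Ha Ha'), (IHg _ _ _ Hb Hb').
  - destruct H as (a & Ha & Hm), H' as (a' & Ha' & Hm').
    rewrite (IHg _ _ _ Ha Ha') in Hm. eauto.
  - destruct (Cantor.of_nat n) as [a k]. revert m m' H H'.
    induction k as [|k IHk]; intros m m' H H'; [eauto|].
    destruct H as (s & Hs & Hm), H' as (s' & Hs' & Hm').
    rewrite (IHk _ _ Hs Hs') in Hm. eauto.
  - destruct H as [H0 Hlt], H' as [H0' Hlt'].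
    destruct (lt_eq_lt_dec m m') as [[Hm|Hm]|Hm]; [|exact Hm|].
    + destruct (Hlt' _ Hm) as [r Hr]. specialize (IHf _ _ _ H0 Hr). discriminate.
    + destruct (Hlt _ Hm) as [r Hr]. specialize (IHf _ _ _ H0' Hr). discriminate.
Qed.

Lemma phi_det e n m m' : phi e n m -> phi e n m' -> m = m'.
Proof.
  intros (c & Hc & H) (c' & Hc' & H'). assert (c = c') as <- by (apply godel_inj; congruence).
  eauto using eval_det.
Qed.

(** * A universal function *)

(* An abstract machine.  A state either evaluates the code [e] at [n] or
   returns the value [m]; [K] is a stack of frames, a frame recording what is
   to be done with a returned value. *)
Definition st_ev (e n K : nat) : nat := cp 0 (cp (cp e n) K).
Definition st_rt (m K : nat) : nat := cp 1 (cp m K).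
Definition push (fr K : nat) : nat := S (cp fr K).
Definition fr_pair_right (g n : nat) : nat := cp 0 (cp g n).
Definition fr_pair_left (a : nat) : nat := cp 1 a.
Definition fr_comp (f : nat) : nat := cp 2 f.
(* [i] rounds of the recursion are done, [r] remain. *)
Definition fr_prec (g a i r : nat) : nat := cp 3 (cp (cp g a) (cp i r)).
Definition fr_mu (f n i : nat) : nat := cp 4 (cp (cp f n) i).

(** [t] and [b] are the halves of a Goedel number. Truncated subtraction makes [ifz (t - i)] the
    test [t <= i], so the cascade separates the tags assigned by [godel]. *)
Definition step_ev (t b n K : nat) : nat :=
  ifz t (st_rt 0 K) (
  ifz (t - 1) (st_rt (S n) K) (
  ifz (t - 2) (st_rt (pi1 n) K) (
  ifz (t - 3) (st_rt (pi2 n) K) (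
  ifz (t - 4) (st_ev (pi1 b) n (push (fr_pair_right (pi2 b) n) K)) (
  ifz (t - 5) (st_ev (pi2 b) n (push (fr_comp (pi1 b)) K)) (
  ifz (t - 6) (st_ev (pi1 b) (pi1 n) (push (fr_prec (pi2 b) (pi1 n) 0 (pi2 n)) K))
  (st_ev b (cp n 0) (push (fr_mu b n 0) K)))))))).

Definition step_rt (t b m K : nat) : nat :=
  ifz t (st_ev (pi1 b) (pi2 b) (push (fr_pair_left m) K)) (
  ifz (t - 1) (st_rt (cp b m) K) (
  ifz (t - 2) (st_ev b m K) (
  ifz (t - 3)
    (ifz (pi2 (pi2 b)) (st_rt m K)
      (st_ev (pi1 (pi1 b)) (cp (pi2 (pi1 b)) (cp (pi1 (pi2 b)) m))
        (push (fr_prec (pi1 (pi1 b)) (pi2 (pi1 b)) (S (pi1 (pi2 b)))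
                 (pred (pi2 (pi2 b)))) K)))
    (ifz m (st_rt (pi2 b) K)
      (st_ev (pi1 (pi1 b)) (cp (pi2 (pi1 b)) (S (pi2 b)))
        (push (fr_mu (pi1 (pi1 b)) (pi2 (pi1 b)) (S (pi2 b))) K)))))).

Definition step (s : nat) : nat :=
  ifz (pi1 s)
    (step_ev (pi1 (pi1 (pi1 (pi2 s)))) (pi2 (pi1 (pi1 (pi2 s)))) (pi2 (pi1 (pi2 s)))
       (pi2 (pi2 s)))
    (ifz (pi2 (pi2 s)) s
      (step_rt (pi1 (pi1 (pred (pi2 (pi2 s))))) (pi2 (pi1 (pred (pi2 (pi2 s)))))
         (pi1 (pi2 s)) (pi2 (pred (pi2 (pi2 s)))))).

Lemma recursive_step_fun : recursive step.
Proof.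
  unfold step, step_ev, step_rt, st_ev, st_rt, push, fr_pair_right, fr_pair_left,
    fr_comp, fr_prec, fr_mu. recursive.
Qed.

Lemma step_st_ev e n K : step (st_ev e n K) = step_ev (pi1 e) (pi2 e) n K.
Proof. unfold step, st_ev. now rewrite !pi2_cp, !pi1_cp, !pi2_cp. Qed.

Lemma step_st_rt m fr K : step (st_rt m (push fr K)) = step_rt (pi1 fr) (pi2 fr) m K.
Proof. unfold step, st_rt, push. rewrite !pi2_cp, !pi1_cp. cbn [ifz pred]. now rewrite pi1_cp, pi2_cp. Qed.

Definition reaches (s s' : nat) : Prop := exists t, Nat.iter t step s = s'.

Lemma reaches_refl s : reaches s s.
Proof. now exists 0. Qed.

Lemma reaches_trans s1 s2 s3 : reaches s1 s2 -> reaches s2 s3 -> reaches s1 s3.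
Proof. intros [t <-] [t' <-]. exists (t' + t). apply Nat.iter_add. Qed.

Lemma reaches_step s s' : reaches (step s) s' -> reaches s s'.
Proof. apply reaches_trans. now exists 1. Qed.

Ltac machine_step :=
  apply reaches_step; rewrite ?step_st_ev, ?step_st_rt; unfold step_ev, step_rt;
  unfold fr_pair_right, fr_pair_left, fr_comp, fr_prec, fr_mu;
  rewrite ?pi1_cp, ?pi2_cp, ?pi1_cp, ?pi2_cp, ?pi1_cp, ?pi2_cp; cbn [Nat.sub ifz pred];
  rewrite ?pi1_cp, ?pi2_cp.

(** The stack [K] is arbitrary, so that the induction hypothesis applies to a subcomputation running
    under the frame of its parent. *)
Lemma eval_reaches c : forall n m, eval c n m ->
  forall K, reaches (st_ev (godel c) n K) (st_rt m K).
Proof.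
  induction c as [| | | |f IHf g IHg|f IHf g IHg|f IHf g IHg|f IHf]; cbn [eval godel];
    intros n m H K; fold (cp 0 0) (cp 1 0) (cp 2 0) (cp 3 0); try (subst m).
  1-4: machine_step; apply reaches_refl.
  - change (Cantor.to_nat (4, Cantor.to_nat (godel f, godel g)))
      with (cp 4 (cp (godel f) (godel g))).
    destruct H as (a & b & Ha & Hb & ->).
    machine_step. eapply reaches_trans; [apply IHf, Ha|].
    machine_step. eapply reaches_trans; [apply IHg, Hb|].
    machine_step. apply reaches_refl.
  - change (Cantor.to_nat (5, Cantor.to_nat (godel f, godel g)))
      with (cp 5 (cp (godel f) (godel g))).
    destruct H as (a & Ha & Hm).
    machine_step. eapply reaches_trans; [apply IHg, Ha|].
    machine_step. apply IHf, Hm.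
  - change (Cantor.to_nat (6, Cantor.to_nat (godel f, godel g)))
      with (cp 6 (cp (godel f) (godel g))).
    machine_step. unfold pi1, pi2. destruct (Cantor.of_nat n) as [a k]. cbn [fst snd].
    fold (fr_prec (godel g) a 0 k).
    assert (Hk : forall i r, k = i + r -> forall s,
      (fix rec (i r : nat) {struct i} : Prop :=
         match i with
         | 0 => eval f a r
         | S i' => exists s, rec i' s
             /\ eval g (Cantor.to_nat (a, Cantor.to_nat (i', s))) r
         end) i s ->
      reaches (st_ev (godel f) a (push (fr_prec (godel g) a 0 k) K))
              (st_rt s (push (fr_prec (godel g) a i r) K))).
    + induction i as [|i IHi]; intros r E s Hs.
      * cbn in E. subst r. apply IHf, Hs.
      * destruct Hs as (s' & Hs' & Hg).
        eapply reaches_trans; [apply (IHi (S r)); [lia|exact Hs']|].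
        machine_step. apply (IHg _ _ Hg).
    + eapply reaches_trans; [apply (Hk k 0); [lia|exact H]|].
      machine_step. apply reaches_refl.
  - destruct H as [H0 Hlt]. fold (cp 7 (godel f)).
    machine_step. fold (fr_mu (godel f) n 0).
    assert (Hi : forall i, i <= m ->
      reaches (st_ev (godel f) (cp n 0) (push (fr_mu (godel f) n 0) K))
              (st_ev (godel f) (cp n i) (push (fr_mu (godel f) n i) K))).
    + induction i as [|i IHi]; intros Hi; [apply reaches_refl|].
      eapply reaches_trans; [apply IHi; lia|].
      destruct (Hlt i Hi) as [r Hr].
      eapply reaches_trans; [apply IHf, Hr|].
      machine_step. apply reaches_refl.
    + eapply reaches_trans; [apply (Hi m); lia|].
      eapply reaches_trans; [apply IHf, H0|].
      machine_step. apply reaches_refl.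
Qed.

Lemma universal_code :
  exists u, forall e n m, phi e n m -> eval u (cp e n) m.
Proof.
  set (run := fun w t => Nat.iter t step (st_ev (pi1 w) (pi2 w) 0)).
  assert (Hrun : recursive2 run).
  { apply (recursive_iter step (fun w => st_ev (pi1 (pi1 w)) (pi2 (pi1 w)) 0) pi2
             recursive_step_fun); unfold st_ev; recursive. }
  (* Zero exactly when a value is returned to the empty stack: the result is [1] while the state
     evaluates a code, and otherwise the stack, which [push] makes positive. *)
  set (unfinished := fun w t => ifz (pi1 (run w t)) 1 (pi2 (pi2 (run w t)))).
  assert (Hu : recursive2 unfinished) by (unfold unfinished; recursive).
  assert (Ho : recursive (fun w => pi1 (pi2 (run (pi1 w) (pi2 w))))) by recursive.
  destruct Hu as [cu Hcu], Ho as [co Hco], recursive_id as [ci Hci].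
  exists (c_comp co (c_pair ci (c_mu cu))). intros e n m (c & <- & Hm).
  destruct (eval_reaches c n m Hm 0) as [t Ht].
  assert (Hfin : unfinished (cp (godel c) n) t = 0).
  { unfold unfinished, run. rewrite pi1_cp, pi2_cp, Ht. unfold st_rt.
    now rewrite pi1_cp, !pi2_cp. }
  destruct (least_witness (fun t => unfinished (cp (godel c) n) t = 0) t Hfin)
    as (t0 & Hle & H0 & Hmin).
  (* a finished state is fixed by [step] *)
  assert (E : run (cp (godel c) n) t = run (cp (godel c) n) t0).
  { unfold run. replace t with ((t - t0) + t0) by lia. rewrite Nat.iter_add.
    fold (run (cp (godel c) n) t0). generalize (t - t0). intros k.
    unfold unfinished in H0. set (s := run _ _) in *.
    assert (Hs : step s = s).
    { unfold step. destruct (pi1 s); [discriminate|]. cbn [ifz] in *. now rewrite H0. }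
    induction k as [|k IHk]; [reflexivity|]. change (step (Nat.iter k step s) = s). now rewrite IHk. }
  exists (cp (cp (godel c) n) t0). split.
  - exists (cp (godel c) n), t0. split; [apply Hci|]. split; [|reflexivity]. split.
    + specialize (Hcu (cp (cp (godel c) n) t0)). cbv beta in Hcu.
      rewrite pi1_cp, pi2_cp, H0 in Hcu. exact Hcu.
    + intros i Hi. exists (pred (unfinished (cp (godel c) n) i)).
      specialize (Hcu (cp (cp (godel c) n) i)). cbv beta in Hcu.
      rewrite pi1_cp, pi2_cp in Hcu. specialize (Hmin i Hi). cbv beta in Hmin.
      replace (S (pred (unfinished (cp (godel c) n) i)))
        with (unfinished (cp (godel c) n) i) by lia.
      exact Hcu.
  - specialize (Hco (cp (cp (godel c) n) t0)). cbv beta in Hco.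
    rewrite !pi1_cp, !pi2_cp, <- E in Hco. unfold run in Hco.
    rewrite pi1_cp, pi2_cp, Ht in Hco. unfold st_rt in Hco.
    now rewrite pi2_cp, pi1_cp in Hco.
Qed.

(** * The combinatory structure of the three algebras *)

(* Totality is only asked for where a realizer has to exist: [ex_fork] and
   [ex_curry] say nothing when the application on the right is undefined. *)
Record pca (A : algebra) : Prop := {
  appl_fun : forall x y z z' : A, appl x y z -> appl x y z' -> z = z';
  comp_appl : forall x y z : A, comp x -> comp y -> appl x y z -> comp z;
  comp_num : forall n, comp (num n : A);
  num_neq : (num 0 : A) <> num 1;
  ex_id : exists i : A, comp i /\ forall a, appl i a a;
  ex_fst : exists i : A, comp i /\ forall a b, appl i (npair a b) a;
  ex_snd : exists i : A, comp i /\ forall a b, appl i (npair a b) b;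
  ex_case : forall x y : A, comp x -> comp y ->
    exists d, comp d /\ appl d (num 0) x /\ appl d (num 1) y;
  ex_curry : forall x : A, comp x -> exists x', comp x' /\ forall a, exists y,
    appl x' a y /\ forall b z, appl x (npair a b) z -> appl y b z;
  ex_fork : exists s : A, comp s /\ forall a b c u v w,
    appl a c u -> appl b c v -> appl u v w -> appl s (npair (npair a b) c) w
}.

Lemma phi_of_recursive f : recursive f -> exists e, forall n, phi e n (f n).
Proof. intros [c Hc]. exists (godel c). intros n. exists c. auto. Qed.

(** The ingredient of the s-m-n theorem for the first algebra: freezing an argument amounts to
    composing with a constant code. *)
Lemma recursive_godel_const_code f :
  recursive f -> recursive (fun w => godel (const_code (f w))).
Proof.
  apply (recursive_comp (fun n => godel (const_code n))).
  eapply recursive_ext; [|apply (recursive_rec (fun _ => godel c_zero)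
    (fun _ _ r => cp 5 (cp (godel c_succ) r)) (fun w => w))]; recursive.
  intros n. induction n as [|n IHn]; [reflexivity|]. cbn [nat_rect]. now rewrite IHn.
Qed.

Lemma K1_pca : pca K1.
Proof.
  destruct universal_code as [u Hu].
  constructor; cbn [carrier comp appl npair num K1].
  - apply phi_det.
  - auto.
  - auto.
  - discriminate.
  - destruct (phi_of_recursive _ recursive_id) as [i Hi]. eauto.
  - destruct (phi_of_recursive pi1 ltac:(recursive)) as [i Hi]. exists i. split; [exact I|].
    intros a b. specialize (Hi (cp a b)). now rewrite pi1_cp in Hi.
  - destruct (phi_of_recursive pi2 ltac:(recursive)) as [i Hi]. exists i. split; [exact I|].
    intros a b. specialize (Hi (cp a b)). now rewrite pi2_cp in Hi.
  - intros x y _ _.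
    destruct (phi_of_recursive (fun w => ifz w x y) ltac:(recursive)) as [d Hd].
    exists d. split; [exact I|]. split; [apply (Hd 0)|apply (Hd 1)].
  - intros x _. destruct recursive_id as [ci Hci].
    (* The numbers 5 and 4 are the Goedel tags of [c_comp] and [c_pair]: this is the index of
       [b |-> x <a, b>], computed from [a] without running [x]. *)
    destruct (phi_of_recursive
      (fun a => cp 5 (cp x (cp 4 (cp (godel (const_code a)) (godel ci)))))) as [x' Hx'].
    { recursive. now apply recursive_godel_const_code, recursive_id. }
    exists x'. split; [exact I|]. intros a. eexists. split; [apply Hx'|].
    intros b z (c & <- & Hz). exists (c_comp c (c_pair (const_code a) ci)).
    split; [reflexivity|]. exists (cp a b). split; [|exact Hz].
    exists a, b. split; [apply eval_const_code|]. split; [apply Hci|reflexivity].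
  - destruct (recursive_cp (fun w => pi1 (pi1 w)) pi2) as [ca Hca]; [recursive..|].
    destruct (recursive_cp (fun w => pi2 (pi1 w)) pi2) as [cb Hcb]; [recursive..|].
    exists (godel (c_comp u (c_pair (c_comp u ca) (c_comp u cb)))). split; [exact I|].
    intros a b c v w z Hv Hw Hz.
    eexists. split; [reflexivity|]. exists (cp v w). split; [|apply Hu, Hz].
    exists v, w. split; [|split; [|reflexivity]].
    + exists (cp a c). split; [|apply Hu, Hv].
      specialize (Hca (cp (cp a b) c)). cbv beta in Hca.
      rewrite !pi1_cp, pi2_cp in Hca. exact Hca.
    + exists (cp b c). split; [|apply Hu, Hw].
      specialize (Hcb (cp (cp a b) c)). cbv beta in Hcb.
      rewrite pi1_cp, !pi2_cp in Hcb. exact Hcb.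
Qed.

(** * Kleene's second algebra *)

(* A partial approximation [p] of a sequence [y]: the value [0] means
   "unknown", [S v] means "the value is [v]". *)
Definition approximates (p y : nat -> nat) : Prop :=
  forall m, p m = 0 \/ p m = S (y m).

(** Built from the last entry backwards, since prepending is what primitive recursion on [t] can do:
    stage [t] codes the last [t] of the values of [y] below [i]. *)
Fixpoint segment_code (y : nat -> nat) (i t : nat) : nat :=
  match t with
  | 0 => 0
  | S t' => S (cp (y (i - S t')) (segment_code y i t'))
  end.
Definition query_code (n : nat) (y : nat -> nat) (i : nat) : nat :=
  S (cp n (segment_code y i i)).

Lemma segment_code_spec y i t :
  t <= i -> segment_code y i t = seq_code (map y (seq (i - t) t)).
Proof.
  induction t as [|t IHt]; intros Ht; [reflexivity|].
  cbn [segment_code seq map seq_code]. rewrite IHt by lia.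
  replace (S (i - S t)) with (i - t) by lia. reflexivity.
Qed.

Lemma query_code_spec n y i : query_code n y i = seq_code (n :: map y (seq 0 i)).
Proof.
  unfold query_code. rewrite segment_code_spec by lia. now rewrite Nat.sub_diag.
Qed.

Lemma query_code_ext n y y' i :
  (forall j, j < i -> y j = y' j) -> query_code n y i = query_code n y' i.
Proof.
  intros H. rewrite !query_code_spec. do 2 f_equal. apply map_ext_in.
  intros j Hj%in_seq. apply H. lia.
Qed.

Lemma le_seq_code l : length l <= seq_code l.
Proof.
  induction l as [|a l IHl]; cbn; [lia|]. fold (cp a (seq_code l)).
  enough (seq_code l <= cp a (seq_code l)) by lia.
  pose proof (Cantor.to_nat_non_decreasing a (seq_code l)). unfold cp. lia.
Qed.

Lemma le_query_code n y i : i <= query_code n y i.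
Proof.
  rewrite query_code_spec. etransitivity; [|apply le_seq_code].
  cbn. rewrite length_map, length_seq. lia.
Qed.

Definition all_known (p : nat -> nat) (i : nat) : nat :=
  nat_rect (fun _ => nat) 1 (fun j r => ifz (p j) 0 r) i.

Lemma all_known_spec p i : all_known p i <> 0 <-> forall j, j < i -> p j <> 0.
Proof.
  induction i as [|i IHi]; [cbn; split; [lia|discriminate]|].
  change (all_known p (S i)) with (ifz (p i) 0 (all_known p i)).
  destruct (p i) as [|v] eqn:E; cbn [ifz].
  - split; [congruence|]. intros H. exfalso. apply (H i); [lia|exact E].
  - rewrite IHi. split; intros H j Hj; [|apply H; lia].
    destruct (Nat.eq_dec j i) as [->|]; [congruence|apply H; lia].
Qed.

Definition probe (px py : nat -> nat) (n i : nat) : nat :=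
  ifz (all_known py i) 0 (px (query_code n (fun j => pred (py j)) i)).

(* The first [g i], [i < k], different from [1]; if there is none, [1]. *)
Definition first_not_one (g : nat -> nat) (k : nat) : nat :=
  nat_rect (fun _ => nat) 1 (fun i r => ifz r 0 (ifz (pred r) (g i) r)) k.

Lemma first_not_one_spec g k :
  (first_not_one g k = 1 /\ forall i, i < k -> g i = 1)
  \/ exists i, i < k /\ g i = first_not_one g k /\ g i <> 1
       /\ forall j, j < i -> g j = 1.
Proof.
  induction k as [|k IHk]; [left; split; [reflexivity|lia]|].
  change (first_not_one g (S k))
    with (ifz (first_not_one g k) 0 (ifz (pred (first_not_one g k)) (g k) (first_not_one g k))).
  destruct IHk as [[E H]|(i & Hi & E & Hne & H)].
  - rewrite E. cbn [ifz pred]. destruct (Nat.eq_dec (g k) 1) as [Ek|Ek].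
    + left. split; [exact Ek|]. intros i Hi.
      destruct (Nat.eq_dec i k) as [->|]; [exact Ek|apply H; lia].
    + right. exists k. auto with arith.
  - right. exists i. rewrite <- E. destruct (g i) as [|[|v]] eqn:Ei; [|congruence|];
      cbn [ifz pred]; repeat split; auto with arith.
Qed.

(* Approximate application, with fuel [k].  A probe answers [0] for
   "unknown" and [1] for the entry [0] of [x], which asks for one more value
   of [y]. *)
Definition approx_app (k : nat) (px py : nat -> nat) (n : nat) : nat :=
  pred (first_not_one (probe px py n) k).

Lemma probe_sound px py x y n i :
  approximates px x -> approximates py y ->
  probe px py n i = 0 \/ probe px py n i = S (x (query_code n y i)).
Proof.
  intros Hx Hy. unfold probe. destruct (all_known py i) as [|v] eqn:E; [now left|].
  cbn [ifz].
  rewrite (query_code_ext n (fun j => pred (py j)) y); [apply Hx|].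
  intros j Hj. assert (H : py j <> 0) by (apply (all_known_spec py i); lia).
  destruct (Hy j) as [Hj0|Hj1]; [contradiction|]. now rewrite Hj1.
Qed.

Lemma k2_app_query x y z :
  k2_app x y z <-> forall n, exists k,
    x (query_code n y k) = S (z n) /\ forall i, i < k -> x (query_code n y i) = 0.
Proof.
  unfold k2_app.
  split; intros H n; destruct (H n) as (k & Hk & Hlt); exists k;
    (split; [|intros i Hi; specialize (Hlt i Hi)]);
    rewrite ?query_code_spec, <- ?query_code_spec in *; auto.
Qed.

(** An unknown probe stops the search with the answer unknown. A known result therefore comes from
    an index below which all entries of [x] are known to be zero, which is the least index of
    [k2_app]. *)
Lemma approx_app_sound k px py x y z :
  approximates px x -> approximates py y -> k2_app x y z ->
  approximates (approx_app k px py) z.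
Proof.
  intros Hx Hy Hz n. destruct (proj1 (k2_app_query x y z) Hz n) as (m & Hm & Hlt).
  unfold approx_app.
  destruct (first_not_one_spec (probe px py n) k) as [[-> _]|(i & Hi & <- & Hne & Hbelow)];
    [now left|].
  destruct (probe_sound px py x y n i Hx Hy) as [E|E]; [rewrite E; now left|].
  rewrite E in Hne |- *. cbn [pred].
  assert (i = m) as ->; [|auto].
  destruct (lt_eq_lt_dec i m) as [[Him|Him]|Him]; [|exact Him|].
  - rewrite Hlt in Hne by exact Him. congruence.
  - specialize (Hbelow m Him).
    destruct (probe_sound px py x y n m Hx Hy) as [E'|E']; rewrite E' in Hbelow; congruence.
Qed.

(* A family of approximations, indexed by the fuel and by the length of the
   part of the input that has been read. *)
Definition converges (P : nat -> nat -> nat -> nat) (y : nat -> nat) : Prop :=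
  (forall f s, approximates (P f s) y)
  /\ forall n, exists N, forall f s, N <= f -> N <= s -> P f s n <> 0.

Lemma converges_below P y : converges P y ->
  forall B, exists N, forall f s, N <= f -> N <= s -> forall n, n < B -> P f s n <> 0.
Proof.
  intros [_ H]. induction B as [|B [N HN]]; [exists 0; lia|].
  destruct (H B) as [N' HN']. exists (N + N'). intros f s Hf Hs n Hn.
  destruct (Nat.eq_dec n B) as [->|]; [apply HN'|apply HN]; lia.
Qed.

Lemma bounded_values (g : nat -> nat) k : exists B, forall i, i <= k -> g i < B.
Proof.
  induction k as [|k [B HB]]; [exists (S (g 0)); intros i ->%Nat.le_0_r; lia|].
  exists (B + S (g (S k))). intros i Hi.
  destruct (Nat.eq_dec i (S k)) as [->|Hne]; [lia|]. specialize (HB i ltac:(lia)). lia.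
Qed.

(** Continuity of application: the value at [n] uses [y] below the least index [m] and [x] at the
    query codes up to [m], all bounded by [B]. Enough fuel and input make these finitely many
    entries known. *)
Lemma converges_app PX PY x y z :
  converges PX x -> converges PY y -> k2_app x y z ->
  converges (fun f s => approx_app f (PX f s) (PY f s)) z.
Proof.
  intros HX HY Hz. split.
  { intros f s. apply (approx_app_sound _ _ _ x y); [apply HX|apply HY|exact Hz]. }
  intros n. destruct (proj1 (k2_app_query x y z) Hz n) as (m & Hm & Hlt).
  destruct (bounded_values (query_code n y) m) as [B HB].
  destruct (converges_below _ _ HX B) as [N1 HN1].
  destruct (converges_below _ _ HY m) as [N2 HN2].
  exists (N1 + N2 + S m). intros f s Hf Hs. specialize (HN1 f s ltac:(lia) ltac:(lia)).
  specialize (HN2 f s ltac:(lia) ltac:(lia)). unfold approx_app.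
  assert (Hp : forall i, i <= m -> probe (PX f s) (PY f s) n i = S (x (query_code n y i))).
  { intros i Hi.
    destruct (probe_sound (PX f s) (PY f s) x y n i (proj1 HX f s) (proj1 HY f s)) as [E|E];
      [|exact E].
    exfalso. unfold probe in E. destruct (all_known (PY f s) i) as [|v] eqn:Ek.
    - apply (proj2 (all_known_spec (PY f s) i)) in Ek; [exact Ek|].
      intros j Hj. apply HN2. lia.
    - cbn [ifz] in E. rewrite (query_code_ext n _ y) in E.
      + revert E. apply HN1, HB, Hi.
      + intros j Hj. destruct (proj1 HY f s j) as [E0|E0]; [|now rewrite E0].
        exfalso. revert E0. apply HN2. lia. }
  destruct (first_not_one_spec (probe (PX f s) (PY f s) n) f)
    as [[_ H]|(i & Hi & <- & Hne & H)].
  - specialize (H m ltac:(lia)). rewrite Hp, Hm in H by lia. discriminate.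
  - destruct (le_lt_dec i m) as [Him|Him].
    + rewrite Hp in Hne |- * by exact Him. cbn [pred]. congruence.
    + specialize (H m Him). rewrite Hp, Hm in H by lia. discriminate.
Qed.

(** * Elements of Baire space given by approximators *)

Definition hd_code (c : nat) : nat := pi1 (pred c).
Definition tl_code (c : nat) : nat := pi2 (pred c).
Definition list_approx (l j : nat) : nat :=
  ifz (Nat.iter j tl_code l) 0 (S (hd_code (Nat.iter j tl_code l))).
Definition restrict (s : nat) (p : nat -> nat) (j : nat) : nat := ifz (s - j) 0 (p j).
Definition prefix (s : nat) (y : nat -> nat) : nat -> nat := restrict s (fun j => S (y j)).

Lemma list_approx_map y s a :
  list_approx (seq_code (map y (seq a s))) = prefix s (fun j => y (a + j)).
Proof.
  apply functional_extensionality. intros j. revert a j.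
  induction s as [|s IHs]; intros a j; unfold prefix, restrict.
  - cbn [seq map seq_code Nat.sub ifz]. unfold list_approx.
    replace (Nat.iter j tl_code 0) with 0; [reflexivity|].
    induction j as [|j IHj]; [reflexivity|].
    change (Nat.iter (S j) tl_code 0) with (tl_code (Nat.iter j tl_code 0)).
    now rewrite <- IHj.
  - cbn [seq map seq_code]. fold (cp (y a) (seq_code (map y (seq (S a) s)))).
    unfold list_approx. destruct j as [|j].
    + cbn [Nat.iter nat_rect ifz Nat.sub]. unfold hd_code. cbn [pred].
      rewrite pi1_cp. do 2 f_equal. lia.
    + rewrite Nat.iter_succ_r. unfold tl_code at 2 4. cbn [pred]. rewrite pi2_cp.
      specialize (IHs (S a) j). unfold list_approx in IHs. rewrite IHs.
      unfold prefix, restrict. cbn [Nat.sub]. do 3 f_equal. lia.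
Qed.

(* The element of the second algebra with approximator [Phi]; the code read
   so far is itself used as fuel. *)
Definition element (Phi : nat -> (nat -> nat) -> nat -> nat) (c : nat) : nat :=
  Phi c (list_approx (tl_code c)) (hd_code c).

Lemma element_query Phi n y s :
  element Phi (query_code n y s) = Phi (query_code n y s) (prefix s y) n.
Proof.
  unfold element. f_equal.
  - unfold query_code at 1, tl_code. cbn [pred].
    rewrite pi2_cp, segment_code_spec by lia. rewrite Nat.sub_diag. apply list_approx_map.
  - unfold hd_code, query_code. cbn [pred]. apply pi1_cp.
Qed.

(** Every known answer is correct, so the first one met is; one is met because the fuel
    [query_code n y s] is at least [s]. *)
Lemma element_app Phi y z :
  converges (fun f s => Phi f (prefix s y)) z -> k2_app (element Phi) y z.
Proof.
  intros [Hs Hc]. apply k2_app_query. intros n. destruct (Hc n) as [N HN].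
  destruct (least_witness (fun k => element Phi (query_code n y k) <> 0) N) as (k & _ & Hk & Hlt).
  { rewrite element_query. apply HN; [apply le_query_code|lia]. }
  exists k. split.
  - rewrite element_query in *.
    now destruct (Hs (query_code n y k) k n) as [E|E].
  - intros i Hi. specialize (Hlt i Hi). tauto.
Qed.

Lemma k2_app_fun x y z z' : k2_app x y z -> k2_app x y z' -> z = z'.
Proof.
  intros H H'. apply functional_extensionality. intros n.
  destruct (H n) as (k & Hk & Hlt), (H' n) as (k' & Hk' & Hlt').
  destruct (lt_eq_lt_dec k k') as [[E|E]|E].
  - rewrite Hlt' in Hk by exact E. discriminate.
  - subst k'. congruence.
  - rewrite Hlt in Hk' by exact E. discriminate.
Qed.

Lemma converges_prefix y : converges (fun _ s => prefix s y) y.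
Proof.
  split.
  - intros f s m. unfold prefix, restrict. destruct (s - m); cbn; auto.
  - intros n. exists (S n). intros f s _ Hs. unfold prefix, restrict.
    destruct (s - n) eqn:E; [lia|discriminate].
Qed.

Lemma converges_prefix_fuel y : converges (fun f _ => prefix f y) y.
Proof.
  split.
  - intros f s. apply (proj1 (converges_prefix y) s f).
  - intros n. destruct (proj2 (converges_prefix y) n) as [N HN]. exists N.
    exact (fun f s Hf Hs => HN s f Hs Hf).
Qed.

Lemma converges_total y : converges (fun _ _ m => S (y m)) y.
Proof. split; [intros f s m; now right|]. intros n. exists 0. discriminate. Qed.

Lemma converges_reindex P y g :
  converges P y -> converges (fun f s m => P f s (g m)) (fun m => y (g m)).
Proof. intros [Hs Hc]. split; [intros f s m; apply Hs|intros n; apply Hc]. Qed.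

Lemma converges_interleave P Q x y : converges P x -> converges Q y ->
  converges (fun f s => interleave (P f s) (Q f s)) (interleave x y).
Proof.
  intros [HP HP'] [HQ HQ']. unfold interleave. split.
  - intros f s m. destruct (Nat.even m); [apply HP|apply HQ].
  - intros n. destruct (Nat.even n); [apply HP'|apply HQ'].
Qed.

Lemma interleave_even x y m : interleave x y (2 * m) = x m.
Proof. unfold interleave. now rewrite Nat.even_mul, Nat.div2_double. Qed.

Lemma interleave_odd x y m : interleave x y (S (2 * m)) = y m.
Proof.
  unfold interleave. now rewrite Nat.even_succ, Nat.odd_mul, Nat.div2_succ_double.
Qed.

Lemma converges_ext P y y' : (forall m, y m = y' m) -> converges P y -> converges P y'.
Proof. intros E. now replace y' with y by (apply functional_extensionality; exact E). Qed.

Lemma converges_fst P x y :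
  converges P (interleave x y) -> converges (fun f s m => P f s (2 * m)) x.
Proof.
  intros H. eapply converges_ext; [|apply (converges_reindex _ _ _ H)].
  intros m. apply interleave_even.
Qed.

Lemma converges_snd P x y :
  converges P (interleave x y) -> converges (fun f s m => P f s (S (2 * m))) y.
Proof.
  intros H. eapply converges_ext; [|apply (converges_reindex _ _ (fun m => S (2 * m)) H)].
  intros m. apply interleave_odd.
Qed.

(** * The combinators on Baire space *)

Definition fork_approx (f : nat) (p : nat -> nat) : nat -> nat :=
  let c := fun m => p (S (2 * m)) in
  approx_app f (approx_app f (fun m => p (2 * (2 * m))) c)
               (approx_app f (fun m => p (2 * (S (2 * m)))) c).

Definition case_approx (x y : nat -> nat) (f : nat) (p : nat -> nat) (n : nat) : nat :=
  ifz (p 0) 0 (ifz (pred (p 0)) (S (x n)) (S (y n))).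

Definition section_approx (x a : nat -> nat) (f : nat) (p : nat -> nat) : nat -> nat :=
  approx_app f (fun m => S (x m)) (interleave (prefix f a) p).

(* Entry [m] of the element coding [b |-> x <a, b>] only depends on the first
   [m] values of [a]. *)
Definition curry_approx (x : nat -> nat) (f : nat) (p : nat -> nat) (m : nat) : nat :=
  ifz (p m) 0
    (S (approx_app m (fun m => S (x m))
          (interleave (restrict m p) (list_approx (tl_code m))) (hd_code m))).

(** Each entry of the result runs [x] with bounded fuel, so nothing is assumed about convergence.
    Waiting for entry [m] of [a] guarantees that all earlier entries have been read. *)
Lemma curry_app x a : k2_app (element (curry_approx x)) a (element (section_approx x a)).
Proof.
  apply element_app.
  destruct (converges_prefix a) as [Hs Hc]. split.
  - intros f s m. unfold curry_approx. destruct (Hs f s m) as [E|E]; rewrite E; [now left|].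
    right. cbn [ifz]. unfold element, section_approx.
    replace (restrict m (prefix s a)) with (prefix m a); [reflexivity|].
    apply functional_extensionality. intros j.
    unfold prefix, restrict in *. destruct (m - j) eqn:Em; [reflexivity|]. cbn [ifz].
    destruct (s - m) eqn:Esm; [discriminate|].
    destruct (s - j) eqn:Esj; [lia|reflexivity].
  - intros n. destruct (Hc n) as [N HN]. exists N. intros f s Hf Hs'.
    specialize (HN f s Hf Hs'). unfold curry_approx. now destruct (prefix s a n).
Qed.

Lemma section_app x a b z :
  k2_app x (interleave a b) z -> k2_app (element (section_approx x a)) b z.
Proof.
  intros H. apply element_app. unfold section_approx.
  refine (converges_app (fun _ _ m => S (x m)) (fun f s => interleave (prefix f a) (prefix s b))
    _ _ _ (converges_total x) _ H).
  apply (converges_interleave (fun f _ => prefix f a) (fun _ s => prefix s b)).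
  - apply converges_prefix_fuel.
  - apply converges_prefix.
Qed.

Lemma fork_app a b c u v w : k2_app a c u -> k2_app b c v -> k2_app u v w ->
  k2_app (element fork_approx) (interleave (interleave a b) c) w.
Proof.
  intros Hu Hv Hw. apply element_app. unfold fork_approx.
  pose proof (converges_prefix (interleave (interleave a b) c)) as H.
  pose proof (converges_snd _ _ _ H) as Hc. apply converges_fst in H.
  pose proof (converges_snd _ _ _ H) as Hb. apply converges_fst in H.
  exact (converges_app _ _ _ _ _ (converges_app _ _ _ _ _ H Hc Hu)
           (converges_app _ _ _ _ _ Hb Hc Hv) Hw).
Qed.

Lemma case_app x y n :
  k2_app (element (case_approx x y)) (fun _ => n) (fun m => ifz n (x m) (y m)).
Proof.
  apply element_app. split.
  - intros f [|s] m; [now left|]. right. cbn. now destruct n.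
  - intros m. exists 1. intros f [|s] Hf Hs; [lia|]. cbn. now destruct n.
Qed.

(** * Recursiveness of the approximators *)

Lemma recursive_all_known p i :
  recursive2 p -> recursive i -> recursive (fun w => all_known (p w) (i w)).
Proof.
  intros Hp Hi. unfold all_known.
  apply (recursive_rec (fun _ => 1) (fun w j r => ifz (p w j) 0 r) i); recursive.
Qed.

Lemma recursive_query_code n y i : recursive n -> recursive2 y -> recursive i ->
  recursive (fun w => query_code (n w) (y w) (i w)).
Proof.
  intros Hn Hy Hi. unfold query_code. apply recursive_S, recursive_cp; [exact Hn|].
  eapply recursive_ext; [|apply (recursive_rec (fun _ => 0)
    (fun w t r => S (cp (y w (i w - S t)) r)) i)]; recursive.
  intros w. cbv beta. generalize (i w) at 2 4. intros t.
  induction t as [|t IHt]; [reflexivity|]. cbn [nat_rect segment_code]. now rewrite IHt.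
Qed.

Lemma recursive_approx_app k px py n :
  recursive k -> recursive2 px -> recursive2 py -> recursive n ->
  recursive (fun w => approx_app (k w) (px w) (py w) (n w)).
Proof.
  intros Hk Hx Hy Hn. unfold approx_app, first_not_one. apply recursive_pred.
  apply (recursive_rec (fun _ => 1)
           (fun w i r => ifz r 0 (ifz (pred r) (probe (px w) (py w) (n w) i) r)) k);
    recursive.
  unfold probe. recursive.
  - apply (recursive_all_known (fun w => py (pi1 w))); recursive.
  - apply (recursive_query_code (fun w => n (pi1 w)) (fun w j => pred (py (pi1 w) j)));
      recursive.
Qed.

Lemma recursive_interleave p q m : recursive2 p -> recursive2 q -> recursive m ->
  recursive (fun w => interleave (p w) (q w) (m w)).
Proof.
  intros Hp Hq Hm.
  set (parity := nat_rect (fun _ => nat) 0 (fun _ r => 1 - r)).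
  set (half := nat_rect (fun _ => nat) 0 (fun i r => ifz (parity i) r (S r))).
  assert (Hpar : recursive parity).
  { apply (recursive_rec (fun _ => 0) (fun _ _ r => 1 - r) (fun w => w)); recursive. }
  assert (Hhalf : recursive half).
  { apply (recursive_rec (fun _ => 0) (fun _ i r => ifz (parity i) r (S r)) (fun w => w));
      recursive. }
  assert (E : forall k, parity (2 * k) = 0 /\ parity (S (2 * k)) = 1
                 /\ half (2 * k) = k /\ half (S (2 * k)) = k).
  { induction k as [|k (E1 & E2 & E3 & E4)]; [auto|].
    replace (2 * S k) with (S (S (2 * k))) by lia.
    assert (P : forall i, parity (S i) = 1 - parity i) by reflexivity.
    assert (H : forall i, half (S i) = ifz (parity i) (half i) (S (half i))) by reflexivity.
    rewrite !H, !P, E1, E3. auto. }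
  apply (recursive_ext (fun w => ifz (parity (m w)) (p w (half (m w))) (q w (half (m w)))));
    [|recursive].
  intros w. destruct (Nat.Even_or_Odd (m w)) as [[k ->]|[k ->]];
    destruct (E k) as (E1 & E2 & E3 & E4).
  - now rewrite interleave_even, E1, E3.
  - now rewrite Nat.add_1_r, interleave_odd, E2, E4.
Qed.

Lemma recursive_restrict s p j : recursive s -> recursive2 p -> recursive j ->
  recursive (fun w => restrict (s w) (p w) (j w)).
Proof. intros Hs Hp Hj. unfold restrict. recursive. Qed.

Lemma recursive_hd_code : recursive hd_code.
Proof. unfold hd_code. recursive. Qed.

Lemma recursive_tl_code : recursive tl_code.
Proof. unfold tl_code. recursive. Qed.

Lemma recursive2_list_approx : recursive2 list_approx.
Proof.
  unfold recursive2, list_approx.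
  pose proof recursive_hd_code. pose proof recursive_tl_code.
  assert (recursive2 (fun l j => Nat.iter j tl_code l))
    by (apply (recursive_iter tl_code pi1 pi2); recursive).
  recursive.
Qed.

(** [Phi] has a function argument; its effectiveness is expressed as closure under recursive
    families with a common parameter [w]. *)
Lemma recursive_element Phi :
  (forall f p n, recursive f -> recursive2 p -> recursive n ->
     recursive (fun w => Phi (f w) (p w) (n w))) ->
  recursive (element Phi).
Proof.
  intros H. pose proof recursive2_list_approx. pose proof recursive_hd_code.
  pose proof recursive_tl_code.
  apply (H (fun c => c) (fun c => list_approx (tl_code c)) hd_code); recursive.
Qed.

Lemma recursive_fork : recursive (element fork_approx).
Proof.
  apply recursive_element. intros f p n Hf Hp Hn. unfold fork_approx.
  apply recursive_approx_app; recursive.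
  all: apply (recursive_approx_app (fun w => f (pi1 w))); recursive.
Qed.

Lemma recursive_case x y :
  recursive x -> recursive y -> recursive (element (case_approx x y)).
Proof.
  intros Hx Hy. apply recursive_element. intros f p n Hf Hp Hn. unfold case_approx.
  recursive.
Qed.

Lemma recursive_curry x : recursive x -> recursive (element (curry_approx x)).
Proof.
  intros Hx. apply recursive_element. intros f p n Hf Hp Hn. unfold curry_approx.
  pose proof recursive2_list_approx. pose proof recursive_hd_code.
  pose proof recursive_tl_code.
  recursive.
  apply (recursive_approx_app n (fun _ m => S (x m))
    (fun w => interleave (restrict (n w) (p w)) (list_approx (tl_code (n w))))); recursive.
  apply (recursive_interleave (fun w => restrict (n (pi1 w)) (p (pi1 w)))
    (fun w => list_approx (tl_code (n (pi1 w))))); recursive.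
  apply (recursive_restrict (fun w => n (pi1 (pi1 w))) (fun w => p (pi1 (pi1 w)))); recursive.
Qed.

(** The unbounded search for the least [k] is total because the application is defined, so it is an
    instance of the mu operator. *)
Lemma recursive_k2_app x y z : recursive x -> recursive y -> k2_app x y z -> recursive z.
Proof.
  intros Hx Hy Hz. rewrite k2_app_query in Hz.
  destruct (choice (fun n k => x (query_code n y k) = S (z n)
    /\ forall i, i < k -> x (query_code n y i) = 0)) as [g Hg]; [exact Hz|].
  assert (Hrec : recursive g).
  { apply (recursive_mu (fun n k => ifz (x (query_code n y k)) 1 0)).
    - recursive. apply (recursive_query_code pi1 (fun _ => y)); recursive.
    - intros n. destruct (Hg n) as [E H]. rewrite E. split; [reflexivity|].
      intros i Hi. now rewrite H. }
  apply (recursive_ext (fun n => pred (x (query_code n y (g n))))).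
  - intros n. now rewrite (proj1 (Hg n)).
  - recursive. apply (recursive_query_code (fun n => n) (fun _ => y)); recursive.
Qed.

Lemma computable_seq_recursive x : computable_seq x <-> recursive x.
Proof.
  split.
  - intros [e He]. destruct (He 0) as (c & Hc & _). exists c. intros n.
    destruct (He n) as (c' & Hc' & Hn).
    now replace c with c' by (apply godel_inj; congruence).
  - apply phi_of_recursive.
Qed.

(** The two cases are [K2] and [KV]. The combinators are recursive and hence serve both. *)
Lemma k2_app_pca (C : (nat -> nat) -> Prop) :
  (forall x, C x) \/ (forall x, C x <-> recursive x) ->
  pca (Algebra (nat -> nat) C k2_app interleave (fun n _ => n)).
Proof.
  intros HC.
  assert (HC1 : forall x, recursive x -> C x)
    by (intros x Hx; destruct HC as [H|H]; [apply H|now apply H]).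
  constructor; cbn [carrier comp appl npair num].
  - apply k2_app_fun.
  - intros x y z Hx Hy Hz. destruct HC as [H|H]; [apply H|].
    rewrite H in *. now apply (recursive_k2_app x y).
  - intros n. apply HC1. recursive.
  - intros E. apply (f_equal (fun x => x 0)) in E. discriminate.
  - exists (element (fun _ p => p)). split.
    + apply HC1, recursive_element. intros f p n Hf Hp Hn. recursive.
    + intros a. apply element_app, converges_prefix.
  - exists (element (fun _ p n => p (2 * n))). split.
    + apply HC1, recursive_element. intros f p n Hf Hp Hn. recursive.
    + intros a b. apply element_app.
      apply (converges_fst (fun _ s => prefix s (interleave a b)) a b), converges_prefix.
  - exists (element (fun _ p n => p (S (2 * n)))). split.
    + apply HC1, recursive_element. intros f p n Hf Hp Hn. recursive.
    + intros a b. apply element_app.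
      apply (converges_snd (fun _ s => prefix s (interleave a b)) a b), converges_prefix.
  - intros x y Hx Hy. exists (element (case_approx x y)). split.
    + destruct HC as [H|H]; [apply H|]. rewrite H in *. now apply recursive_case.
    + split; [apply (case_app x y 0)|apply (case_app x y 1)].
  - intros x Hx. exists (element (curry_approx x)). split.
    + destruct HC as [H|H]; [apply H|]. rewrite H in *. now apply recursive_curry.
    + intros a. eexists. split; [apply curry_app|]. apply section_app.
  - exists (element fork_approx). split; [apply HC1, recursive_fork|]. apply fork_app.
Qed.

Lemma K2_pca : pca K2.
Proof. apply k2_app_pca. now left. Qed.

Lemma KV_pca : pca KV.
Proof. apply k2_app_pca. right. apply computable_seq_recursive. Qed.

(** * Realizers as lambda terms *)

(** Curried forms of the operations of [pca], with every incomplete application defined; abstraction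
    in a call-by-value calculus relies on that. *)
Record combinators (A : algebra) : Type := Combinators {
  kK : A; kS : A; kPair : A; kFst : A; kSnd : A; kIf : A;
  kK_comp : comp kK; kS_comp : comp kS; kPair_comp : comp kPair;
  kFst_comp : comp kFst; kSnd_comp : comp kSnd; kIf_comp : comp kIf;
  kK_spec : forall a, exists y, appl kK a y /\ forall b, appl y b a;
  kS_spec : forall a, exists y, appl kS a y /\ forall b, exists y', appl y b y' /\
    forall c u v w, appl a c u -> appl b c v -> appl u v w -> appl y' c w;
  kPair_spec : forall a, exists y, appl kPair a y /\ forall b, appl y b (npair a b);
  kFst_spec : forall a b, appl kFst (npair a b) a;
  kSnd_spec : forall a b, appl kSnd (npair a b) b;
  kIf_spec0 : exists y, appl kIf (num 0) y /\ forall a, exists y', appl y a y' /\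
    forall b, appl y' b a;
  kIf_spec1 : exists y, appl kIf (num 1) y /\ forall a, exists y', appl y a y' /\
    forall b, appl y' b b
}.
Arguments kK {A}. Arguments kS {A}. Arguments kPair {A}.
Arguments kFst {A}. Arguments kSnd {A}. Arguments kIf {A}.

Lemma combinators_exist (A : algebra) : pca A -> inhabited (combinators A).
Proof.
  intros HA.
  destruct (ex_id A HA) as (i & Ci & Hi).
  destruct (ex_fst A HA) as (p1 & Cp1 & Hp1).
  destruct (ex_snd A HA) as (p2 & Cp2 & Hp2).
  destruct (ex_fork A HA) as (s0 & Cs0 & Hs0).
  destruct (ex_curry A HA p1 Cp1) as (k & Ck & Hk).
  destruct (ex_curry A HA i Ci) as (pr & Cpr & Hpr).
  destruct (ex_curry A HA s0 Cs0) as (s1 & Cs1 & Hs1).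
  destruct (ex_curry A HA s1 Cs1) as (s & Cs & Hs).
  (* [ki] is [K I], the second selector; the conditional chooses between it and [k]. *)
  destruct (Hk i) as (ki & Hki & Hki').
  assert (Cki : comp ki) by exact (comp_appl A HA _ _ _ Ck Ci Hki).
  destruct (ex_case A HA k ki Ck Cki) as (d & Cd & Hd0 & Hd1).
  constructor. apply (Combinators A k s pr p1 p2 d); auto.
  - intros a. destruct (Hk a) as (y & Hy & Hy'). eauto.
  - intros a. destruct (Hs a) as (y & Hy & Hy'). exists y. split; [exact Hy|].
    intros b. destruct (Hs1 (npair a b)) as (y' & Hyb & Hyb'). eauto 8.
  - intros a. destruct (Hpr a) as (y & Hy & Hy'). eauto.
  - exists k. split; [exact Hd0|]. intros a. destruct (Hk a) as (y & Hy & Hy'). eauto.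
  - exists ki. split; [exact Hd1|]. intros a. exists i. auto.
Qed.

Definition scons {T : Type} (a : T) (rho : nat -> T) (n : nat) : T :=
  match n with 0 => a | S m => rho m end.

Section Terms.
Context {A : algebra} (HA : pca A) (K : combinators A).

(* Variables are de Bruijn indices; abstraction is compiled away. *)
Inductive term : Type :=
| Var (n : nat)
| Cst (a : A)
| App (t u : term).

(** Bracket abstraction without the shortcut [K (t u)] for bodies free of the bound variable:
    [lam t] must have a value even where [t] has none. *)
Fixpoint lam (t : term) : term :=
  match t with
  | Var 0 => App (App (Cst (kS K)) (Cst (kK K))) (Cst (kK K))
  | Var (S n) => App (Cst (kK K)) (Var n)
  | Cst a => App (Cst (kK K)) (Cst a)
  | App t u => App (App (Cst (kS K)) (lam t)) (lam u)
  end.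

(* Weakest precondition: [t] has a value, and it satisfies [Q]. *)
Fixpoint wp (rho : nat -> A) (t : term) (Q : A -> Prop) : Prop :=
  match t with
  | Var n => Q (rho n)
  | Cst a => Q a
  | App t u => wp rho t (fun x => wp rho u (fun y => exists b, appl x y b /\ Q b))
  end.

Lemma wp_mono rho t (P Q : A -> Prop) :
  (forall b, P b -> Q b) -> wp rho t P -> wp rho t Q.
Proof.
  revert P Q. induction t as [n|a|t IHt u IHu]; cbn [wp]; intros P Q H; [auto..|].
  apply IHt. intros x. apply IHu. intros y (b & Hb & HP). eauto.
Qed.

Lemma wp_ex rho t (Q : A -> Prop) : wp rho t Q -> exists b, Q b.
Proof.
  revert Q. induction t as [n|a|t IHt u IHu]; cbn [wp]; intros Q H; [eauto..|].
  destruct (IHt _ H) as [x Hx]. destruct (IHu _ Hx) as (y & b & _ & Hb). eauto.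
Qed.

(** The quantifier over [R] sits inside the hypothesis on [f], so a single closure can be used at
    every [p] and [q]; this gives the uniformity demanded of realizers. *)
Lemma wp_lam rho t (Q : A -> Prop) :
  (forall f, (forall a R, wp (scons a rho) t R -> exists b, appl f a b /\ R b) -> Q f) ->
  wp rho (lam t) Q.
Proof.
  revert Q. induction t as [[|n]|a|t IHt u IHu]; intros Q HQ; cbn [lam wp].
  - destruct (kS_spec A K (kK K)) as (y & Hy & Hy'). exists y. split; [exact Hy|].
    destruct (Hy' (kK K)) as (y' & Hyy & Hs). exists y'. split; [exact Hyy|].
    apply HQ. intros a R HR. exists a. split; [|exact HR].
    destruct (kK_spec A K a) as (z & Hz & Hz'). eauto.
  - destruct (kK_spec A K (rho n)) as (y & Hy & Hy'). exists y. split; [exact Hy|].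
    apply HQ. intros a R HR. exists (rho n). auto.
  - destruct (kK_spec A K a) as (y & Hy & Hy'). exists y. split; [exact Hy|].
    apply HQ. intros b R HR. exists a. auto.
  - apply IHt. intros f Hf. destruct (kS_spec A K f) as (y & Hy & Hy').
    exists y. split; [exact Hy|]. apply IHu. intros g Hg.
    destruct (Hy' g) as (y' & Hyy & Hs). exists y'. split; [exact Hyy|].
    apply HQ. intros a R HR. cbn [wp] in HR.
    destruct (Hf _ _ HR) as (x & Hx & HR'). destruct (Hg _ _ HR') as (v & Hv & b & Hb & HRb).
    eauto.
Qed.

Fixpoint const_comp (t : term) : Prop :=
  match t with
  | Var _ => True
  | Cst a => comp a
  | App t u => const_comp t /\ const_comp u
  end.

Lemma const_comp_lam t : const_comp t -> const_comp (lam t).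
Proof.
  pose proof (kK_comp A K). pose proof (kS_comp A K).
  induction t as [[|n]|a|t IHt u IHu]; cbn; intuition.
Qed.

Lemma wp_comp rho t (Q : A -> Prop) :
  (forall n, comp (rho n)) -> const_comp t -> wp rho t Q ->
  wp rho t (fun b => comp b /\ Q b).
Proof.
  intros Hrho. revert Q.
  induction t as [n|a|t IHt u IHu]; cbn [wp const_comp]; intros Q Ht HQ; [auto..|].
  destruct Ht as [Ht Hu].
  refine (wp_mono _ _ _ _ _ (IHt _ Ht HQ)). intros x [Cx Hx].
  refine (wp_mono _ _ _ _ _ (IHu _ Hu Hx)). intros y (Cy & b & Hb & HQb).
  exists b. split; [exact Hb|]. split; [|exact HQb]. exact (comp_appl A HA _ _ _ Cx Cy Hb).
Qed.

(** Source of the realizers below: the wanted property becomes the postcondition of a term. The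
    environment only has to be computable. *)
Lemma comp_realizer (t : term) (Q : A -> Prop) :
  const_comp t -> wp (fun _ => num 0) t Q -> exists e, comp e /\ Q e.
Proof.
  intros Ht HQ. apply (wp_ex (fun _ => num 0) t). apply wp_comp; [|exact Ht|exact HQ].
  intros _. apply (comp_num A HA).
Qed.

Definition tPair (t u : term) : term := App (App (Cst (kPair K)) t) u.
Definition tFst (t : term) : term := App (Cst (kFst K)) t.
Definition tSnd (t : term) : term := App (Cst (kSnd K)) t.
(* The branches are thunks: each stands under one more, unused, binder. *)
Definition tCase (c t0 t1 : term) : term :=
  App (App (App (App (Cst (kIf K)) c) (lam t0)) (lam t1)) (Cst (num 0)).

Lemma wp_pair rho t u (Q : A -> Prop) :
  wp rho t (fun a => wp rho u (fun b => Q (npair a b))) -> wp rho (tPair t u) Q.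
Proof.
  unfold tPair. cbn [wp]. apply wp_mono. intros a Ha.
  destruct (kPair_spec A K a) as (y & Hy & Hy'). exists y. split; [exact Hy|].
  revert Ha. apply wp_mono. eauto.
Qed.

Lemma wp_fst rho t (Q : A -> Prop) :
  wp rho t (fun x => exists a b, x = npair a b /\ Q a) -> wp rho (tFst t) Q.
Proof.
  unfold tFst. cbn [wp]. apply wp_mono. intros x (a & b & -> & Ha).
  exists a. split; [apply (kFst_spec A K)|exact Ha].
Qed.

Lemma wp_snd rho t (Q : A -> Prop) :
  wp rho t (fun x => exists a b, x = npair a b /\ Q b) -> wp rho (tSnd t) Q.
Proof.
  unfold tSnd. cbn [wp]. apply wp_mono. intros x (a & b & -> & Hb).
  exists b. split; [apply (kSnd_spec A K)|exact Hb].
Qed.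

Lemma wp_case rho c t0 t1 (Q : A -> Prop) :
  wp rho c (fun x => (x = num 0 /\ wp (scons (num 0) rho) t0 Q)
                  \/ (x = num 1 /\ wp (scons (num 0) rho) t1 Q)) ->
  wp rho (tCase c t0 t1) Q.
Proof.
  unfold tCase. cbn [wp]. apply wp_mono. intros x [[-> H]|[-> H]].
  - destruct (kIf_spec0 A K) as (y & Hy & Hy'). exists y. split; [exact Hy|].
    apply wp_lam. intros f Hf. destruct (Hy' f) as (y' & Hyf & Hyf').
    exists y'. split; [exact Hyf|]. apply wp_lam. intros g _. exists f. auto.
  - destruct (kIf_spec1 A K) as (y & Hy & Hy'). exists y. split; [exact Hy|].
    apply wp_lam. intros f _. destruct (Hy' f) as (y' & Hyf & Hyf').
    exists y'. split; [exact Hyf|]. apply wp_lam. intros g Hg. exists g. auto.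
Qed.

Definition fixes (y : A) : Prop := forall f, exists z, appl y f z /\
  forall a g c, appl f z g -> appl g a c -> appl z a c.

(** The term is [\f. (\x. x x) (\x a. f (x x) a)]. The abstraction over [a] makes the
    self-application defined before [f] is consulted. *)
Lemma fixpoint_combinator : exists y, comp y /\ fixes y.
Proof.
  apply (comp_realizer (lam (App (lam (App (Var 0) (Var 0)))
    (lam (lam (App (App (Var 2) (App (Var 1) (Var 1))) (Var 0))))))).
  { repeat first [apply const_comp_lam | split]. }
  apply wp_lam. intros y Hy f. apply Hy. cbn [wp].
  apply wp_lam. intros h Hh. apply wp_lam. intros w Hw.
  apply Hh. cbn [wp scons].
  (* The body evaluates [w w] again, so the postcondition for its value [z] takes [appl w w z] as a
     premise. *)
  destruct (Hw w (fun z => forall g a c, appl w w z -> appl f z g -> appl g a c -> appl z a c))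
    as (z & Hz & Hz').
  { apply wp_lam. intros z Hz g a c Hwz Hg Hc.
    destruct (Hz a (fun b => b = c)) as (b & Hb & ->); [|exact Hb].
    cbn [wp scons]. exists z. split; [exact Hwz|]. exists g. split; [exact Hg|]. eauto. }
  exists z. split; [exact Hz|]. eauto.
Qed.

(* In [t] the innermost variable is the argument and the next one the function
   itself. *)
Definition tFix (y : A) (t : term) : term := App (Cst y) (lam (lam t)).

Lemma wp_fix y rho t (Q : A -> Prop) : fixes y ->
  (forall z, (forall a R, wp (scons a (scons z rho)) t R -> exists b, appl z a b /\ R b) ->
     Q z) ->
  wp rho (tFix y t) Q.
Proof.
  intros Hy HQ. unfold tFix. cbn [wp]. apply wp_lam. intros f Hf.
  destruct (Hy f) as (z & Hz & Hfix). exists z. split; [exact Hz|].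
  apply HQ. intros a R HR.
  destruct (Hf z (fun g => exists b, appl g a b /\ R b)) as (g & Hg & b & Hb & HRb); [|eauto].
  apply wp_lam. intros g Hg. exact (Hg a R HR).
Qed.

End Terms.
Arguments Var {A}. Arguments Cst {A}. Arguments App {A}.

Ltac const_comp :=
  repeat first
    [ exact I | assumption | apply comp_num; assumption
    | apply kPair_comp | apply kFst_comp | apply kSnd_comp | apply kIf_comp
    | apply const_comp_lam | split ].
Ltac wp_step :=
  cbn [wp scons];
  lazymatch goal with
  | |- wp _ (tPair _ _ _) _ => apply wp_pair
  | |- wp _ (tFst _ _) _ => apply wp_fst
  | |- wp _ (tSnd _ _) _ => apply wp_snd
  | |- wp _ (tCase _ _ _ _) _ => apply wp_case
  | |- exists a b, npair _ _ = npair a b /\ _ => do 2 eexists; split; [reflexivity|]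
  end.
Ltac wp := repeat wp_step; cbn [wp scons].

(** * The topology generated by an extended predicate *)

(* The codes of Arthur's strategies for which Nimue has answers that make
   every play end in [p]: [<1, a>] halts with [a], [<0, <q, f>>] asks [q] and
   goes on with [f * b] upon the answer [b]. *)
Inductive tree {A : algebra} {M : Type} (G : ext_pred A M) (p : Omega A) : A -> Prop :=
| tree_halt a : p a -> tree G p (npair (num 1) a)
| tree_query q z f :
    ep_dom G q z ->
    (forall b, ep_val G q z b -> exists s, appl f b s) ->
    (forall b s, ep_val G q z b -> appl f b s -> tree G p s) ->
    tree G p (npair (num 0) (npair q f)).

Section Topologies.
Context {A : algebra} (HA : pca A) (K : combinators A).

Lemma npair_inj (a b a' b' : A) : npair a b = npair a' b' -> a = a' /\ b = b'.
Proof.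
  intros E. split.
  - apply (appl_fun A HA (kFst K) (npair a b)); [|rewrite E]; apply kFst_spec.
  - apply (appl_fun A HA (kSnd K) (npair a b)); [|rewrite E]; apply kSnd_spec.
Qed.

(** The constructor splits [imp] into definedness and correctness, which keeps the recursive
    occurrence out of an existential and the induction principle usable. The two halves are rejoined
    here. *)
Lemma tree_ask {M : Type} (G : ext_pred A M) (p : Omega A) q z f :
  ep_dom G q z -> imp (ep_val G q z) (tree G p) f ->
  tree G p (npair (num 0) (npair q f)).
Proof.
  intros Hz Hf. apply (tree_query G p q z f Hz).
  - intros b Hb. destruct (Hf b Hb) as (s & Hs & _). eauto.
  - intros b s Hb Hs. destruct (Hf b Hb) as (s' & Hs' & Ht).
    now rewrite (appl_fun A HA _ _ _ _ Hs Hs').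
Qed.

(** A recursor uniform in [G], [p] and [r]: [h] treats leaves, and [k] a query whose continuation
    [g] already yields folded subtrees. *)
Lemma tree_fold : exists F : A, comp F /\
  forall (M : Type) (G : ext_pred A M) (p r : Omega A) h k,
    imp p r h ->
    (forall q z g, ep_dom G q z -> imp (ep_val G q z) r g ->
       exists v, appl k (npair q g) v /\ r v) ->
    exists v, appl F (npair h k) v /\ imp (tree G p) r v.
Proof.
  destruct (fixpoint_combinator HA K) as (y & Cy & Hy).
  (* Within a branch the thunk shifts the indices: [Var 1] is the node, [Var 2] the recursive
     function and [Var 3] the pair of [h] and [k]. *)
  apply (comp_realizer HA (lam K (tFix K y
    (tCase K (tFst K (Var 0))
      (App (tSnd K (Var 3)) (tPair K (tFst K (tSnd K (Var 1)))
         (lam K (App (Var 3) (App (tSnd K (tSnd K (Var 2))) (Var 0))))))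
      (App (tFst K (Var 3)) (tSnd K (Var 1)))))));
    [const_comp|].
  apply wp_lam. intros F HF M G p r h k Hh Hk. apply HF, wp_fix; [exact Hy|]. intros z Hz s Hs.
  induction Hs as [a Ha|q x f Hx Hdef Hs IH]; apply Hz; wp.
  - right. split; [reflexivity|]. wp. apply Hh, Ha.
  - left. split; [reflexivity|]. wp. apply wp_lam. intros g Hg.
    apply (Hk q x g Hx). intros b Hb. apply Hg. wp. destruct (Hdef b Hb) as (s & Hs').
    exists s. split; [exact Hs'|]. apply (IH b); assumption.
Qed.

(** Monotonicity and multiplication are folds that rebuild the queries by [ask]; the former relabels
    the leaves, the latter grafts the tree found at a leaf. *)
Lemma tree_is_LT {M : Type} (G : ext_pred A M) : is_LT (tree G).
Proof.
  destruct tree_fold as (F & CF & HF).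
  set (ask := lam K (tPair K (Cst (num 0)) (Var 0)) : term).
  assert (Hask : forall rho (Q : A -> Prop),
    (forall k, (forall p q z g, ep_dom G q z -> imp (ep_val G q z) (tree G p) g ->
       exists v, appl k (npair q g) v /\ tree G p v) -> Q k) -> wp rho ask Q).
  { intros rho Q HQ. apply wp_lam. intros k Hk. apply HQ. intros p q z g Hz Hg.
    apply Hk. wp. exact (tree_ask G p q z g Hz Hg). }
  assert (Cask : const_comp ask) by (unfold ask; const_comp).
  constructor.
  - apply (comp_realizer HA (lam K (App (Cst F)
      (tPair K (lam K (tPair K (Cst (num 1)) (App (Var 1) (Var 0)))) ask)))); [const_comp|].
    apply wp_lam. intros e He p q h Hh. apply He. wp. apply wp_lam. intros f Hf.
    apply Hask. intros k Hk. apply HF; [|apply Hk].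
    intros a Ha. apply Hf. wp. destruct (Hh a Ha) as (b & Hb & Hq).
    exists b. split; [exact Hb|]. now apply tree_halt.
  - apply (comp_realizer HA (lam K (tPair K (Cst (num 1)) (Var 0)))); [const_comp|].
    apply wp_lam. intros e He p a Ha. apply He. wp. now apply tree_halt.
  - apply (comp_realizer HA (lam K (App (App (Cst F) (tPair K (lam K (Var 0)) ask)) (Var 0))));
      [const_comp|].
    apply wp_lam. intros e He p s Hs. apply He. wp. apply wp_lam. intros f Hf.
    apply Hask. intros k Hk.
    destruct (HF M G (tree G p) (tree G p) f k) as (v & Hv & Hp); [|apply Hk|].
    + intros a Ha. apply Hf. exact Ha.
    + exists v. split; [exact Hv|]. exact (Hp s Hs).
Qed.

Definition tree_topology {M : Type} (G : ext_pred A M) : topology A :=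
  exist _ (tree G) (tree_is_LT G).

Definition solves {M : Type} (G : ext_pred A M) (j : Omega A -> Omega A) (e : A) : Prop :=
  forall a x, ep_dom G a x -> exists b, appl e a b /\ j (ep_val G a x) b.

(** From left to right, the tree asks one question and halts with the answer. From right to left, a
    tree is folded into [j], with the unit at leaves and, at queries, monotonicity followed by
    multiplication. *)
Lemma tree_universal {M : Type} (G : ext_pred A M) (j : topology A) :
  r_le A (tree_topology G) j <-> exists e, comp e /\ solves G (proj1_sig j) e.
Proof.
  destruct j as [j Hj]. unfold r_le. cbn [proj1_sig tree_topology]. split.
  - intros (e & Ce & He).
    apply (comp_realizer HA (lam K (App (Cst e) (tPair K (Cst (num 0)) (tPair K (Var 0)
      (lam K (tPair K (Cst (num 1)) (Var 0)))))))); [const_comp|].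
    apply wp_lam. intros f Hf a x Hx. apply Hf. wp. apply wp_lam. intros g Hg.
    apply He. apply (tree_ask G _ a x); [exact Hx|].
    intros b Hb. apply Hg. wp. now apply tree_halt.
  - intros (e & Ce & He). destruct tree_fold as (F & CF & HF).
    destruct Hj as [(m & Cm & Hm) (u & Cu & Hu) (t & Ct & Ht)].
    apply (comp_realizer HA (lam K (App (App (Cst F) (tPair K (Cst u)
      (lam K (App (Cst t) (App (App (Cst m) (tSnd K (Var 0)))
         (App (Cst e) (tFst K (Var 0)))))))) (Var 0)))); [const_comp|].
    apply wp_lam. intros f Hf p s Hs. apply Hf. wp. apply wp_lam. intros k Hk.
    destruct (HF M G p (j p) u k) as (v & Hv & Hp).
    + apply Hu.
    + intros q z g Hz Hg. apply Hk. wp.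
      destruct (Hm _ _ g Hg) as (mg & Hmg & Hmg'). exists mg. split; [exact Hmg|]. wp.
      destruct (He q z Hz) as (b & Hb & Hjb). exists b. split; [exact Hb|].
      destruct (Hmg' b Hjb) as (c & Hc & Hjc). exists c. split; [exact Hc|].
      apply Ht, Hjc.
    + exists v. split; [exact Hv|]. exact (Hp s Hs).
Qed.

(** * The Heyting structure on topologies *)

Lemma r_le_refl (j : topology A) : r_le A j j.
Proof.
  apply (comp_realizer HA (lam K (Var 0))); [const_comp|].
  apply wp_lam. intros e He p a Ha. now apply He.
Qed.

Lemma r_le_trans (i j k : topology A) : r_le A i j -> r_le A j k -> r_le A i k.
Proof.
  intros (e & Ce & He) (f & Cf & Hf).
  apply (comp_realizer HA (lam K (App (Cst f) (App (Cst e) (Var 0))))); [const_comp|].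
  apply wp_lam. intros g Hg p a Ha. apply Hg. wp.
  destruct (He p a Ha) as (b & Hb & Hjb). exists b. split; [exact Hb|]. apply Hf, Hjb.
Qed.

Lemma least_topology : exists b, forall j, r_le A b j.
Proof.
  assert (H : is_LT (fun p : Omega A => p)).
  { constructor.
    - apply (comp_realizer HA (lam K (Var 0))); [const_comp|].
      apply wp_lam. intros e He p q h Hh. now apply He.
    - apply (comp_realizer HA (lam K (Var 0))); [const_comp|].
      apply wp_lam. intros e He p a Ha. now apply He.
    - apply (comp_realizer HA (lam K (Var 0))); [const_comp|].
      apply wp_lam. intros e He p a Ha. now apply He. }
  exists (exist _ _ H). intros [j Hj]. apply (LT_unit j Hj).
Qed.

Lemma greatest_topology : exists t, forall j, r_le A j t.
Proof.
  assert (H : is_LT (fun _ : Omega A => fun _ => True)).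
  { constructor.
    - apply (comp_realizer HA (lam K (lam K (Var 0)))); [const_comp|].
      apply wp_lam. intros e He p q h Hh. apply He, wp_lam. intros f Hf a _. now apply Hf.
    - apply (comp_realizer HA (lam K (Var 0))); [const_comp|].
      apply wp_lam. intros e He p a Ha. now apply He.
    - apply (comp_realizer HA (lam K (Var 0))); [const_comp|].
      apply wp_lam. intros e He p a Ha. now apply He. }
  exists (exist _ _ H). intros [j Hj].
  apply (comp_realizer HA (lam K (Var 0))); [const_comp|].
  apply wp_lam. intros e He p a Ha. now apply He.
Qed.

Definition meet_op (j k : Omega A -> Omega A) (p : Omega A) : Omega A :=
  fun x => exists a b, x = npair a b /\ j p a /\ k p b.

Lemma meet_is_LT (j k : Omega A -> Omega A) : is_LT j -> is_LT k -> is_LT (meet_op j k).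
Proof.
  intros [(mj & Cmj & Hmj) (uj & Cuj & Huj) (tj & Ctj & Htj)]
         [(mk & Cmk & Hmk) (uk & Cuk & Huk) (tk & Ctk & Htk)].
  constructor.
  - apply (comp_realizer HA (lam K (lam K
      (tPair K (App (App (Cst mj) (Var 1)) (tFst K (Var 0)))
               (App (App (Cst mk) (Var 1)) (tSnd K (Var 0))))))); [const_comp|].
    apply wp_lam. intros e He p q h Hh. apply He, wp_lam.
    intros f Hf x (a & b & -> & Ha & Hb). apply Hf. wp.
    destruct (Hmj p q h Hh) as (mh & Hmh & Hmh'). exists mh. split; [exact Hmh|]. wp.
    destruct (Hmh' a Ha) as (c & Hc & Hqc). exists c. split; [exact Hc|].
    destruct (Hmk p q h Hh) as (nh & Hnh & Hnh'). exists nh. split; [exact Hnh|]. wp.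
    destruct (Hnh' b Hb) as (d & Hd & Hqd). exists d. split; [exact Hd|].
    exists c, d. auto.
  - apply (comp_realizer HA (lam K (tPair K (App (Cst uj) (Var 0)) (App (Cst uk) (Var 0)))));
      [const_comp|].
    apply wp_lam. intros e He p a Ha. apply He. wp.
    destruct (Huj p a Ha) as (c & Hc & Hqc). exists c. split; [exact Hc|].
    destruct (Huk p a Ha) as (d & Hd & Hqd). exists d. split; [exact Hd|].
    exists c, d. auto.
  - apply (comp_realizer HA (lam K (tPair K
      (App (Cst tj) (App (App (Cst mj) (Cst (kFst K))) (tFst K (Var 0))))
      (App (Cst tk) (App (App (Cst mk) (Cst (kSnd K))) (tSnd K (Var 0)))))));
      [const_comp|].
    apply wp_lam. intros e He p x (a & b & -> & Ha & Hb). apply He. wp.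
    destruct (Hmj (meet_op j k p) (j p) (kFst K)) as (mh & Hmh & Hmh').
    { intros y (c & d & -> & Hc & Hd). exists c. split; [apply kFst_spec|exact Hc]. }
    exists mh. split; [exact Hmh|]. wp.
    destruct (Hmh' a Ha) as (c & Hc & Hqc). exists c. split; [exact Hc|].
    destruct (Htj p c Hqc) as (c' & Hc' & Hqc'). exists c'. split; [exact Hc'|].
    destruct (Hmk (meet_op j k p) (k p) (kSnd K)) as (nh & Hnh & Hnh').
    { intros y (d & d' & -> & Hd & Hd'). exists d'. split; [apply kSnd_spec|exact Hd']. }
    exists nh. split; [exact Hnh|]. wp.
    destruct (Hnh' b Hb) as (d & Hd & Hqd). exists d. split; [exact Hd|].
    destruct (Htk p d Hqd) as (d' & Hd' & Hqd'). exists d'. split; [exact Hd'|].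
    exists c', d'. auto.
Qed.

Definition meet_topology (j k : topology A) : topology A :=
  exist _ _ (meet_is_LT _ _ (proj2_sig j) (proj2_sig k)).

Lemma meet_topology_spec (j k : topology A) : is_meet (r_le A) j k (meet_topology j k).
Proof.
  intros i. unfold r_le. cbn [proj1_sig meet_topology]. split.
  - intros (e & Ce & He). split.
    + apply (comp_realizer HA (lam K (tFst K (App (Cst e) (Var 0))))); [const_comp|].
      apply wp_lam. intros f Hf p a Ha. apply Hf. wp.
      destruct (He p a Ha) as (x & Hx & b & c & -> & Hb & Hc). eauto 6.
    + apply (comp_realizer HA (lam K (tSnd K (App (Cst e) (Var 0))))); [const_comp|].
      apply wp_lam. intros f Hf p a Ha. apply Hf. wp.
      destruct (He p a Ha) as (x & Hx & b & c & -> & Hb & Hc). eauto 6.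
  - intros [(e & Ce & He) (f & Cf & Hf)].
    apply (comp_realizer HA (lam K (tPair K (App (Cst e) (Var 0)) (App (Cst f) (Var 0)))));
      [const_comp|].
    apply wp_lam. intros g Hg p a Ha. apply Hg. wp.
    destruct (He p a Ha) as (b & Hb & Hjb). exists b. split; [exact Hb|].
    destruct (Hf p a Ha) as (c & Hc & Hkc). exists c. split; [exact Hc|].
    exists b, c. auto.
Qed.

(* The tag tells Arthur which of the two topologies the name is for. *)
Definition join_problem (j k : Omega A -> Omega A) : ext_pred A (bool * Omega A) :=
  ExtPred
    (fun a x => let (s, p) := (x : bool * Omega A) in
       if s then exists b, a = npair (num 0) b /\ j p b
       else exists b, a = npair (num 1) b /\ k p b)
    (fun _ x => snd x).

(** A tagged union of [j p] and [k p] offers no multiplication, as layers of [j] and [k] may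
    alternate; trees absorb the alternation. *)
Lemma join_topology_spec (j k : topology A) :
  is_join (r_le A) j k (tree_topology (join_problem (proj1_sig j) (proj1_sig k))).
Proof.
  intros i. rewrite tree_universal. unfold r_le, solves. split.
  - intros (e & Ce & He). split.
    + apply (comp_realizer HA (lam K (App (Cst e) (tPair K (Cst (num 0)) (Var 0)))));
        [const_comp|].
      apply wp_lam. intros f Hf p a Ha. apply Hf. wp. apply (He _ (true, p)). cbn. eauto.
    + apply (comp_realizer HA (lam K (App (Cst e) (tPair K (Cst (num 1)) (Var 0)))));
        [const_comp|].
      apply wp_lam. intros f Hf p a Ha. apply Hf. wp. apply (He _ (false, p)). cbn. eauto.
  - intros [(e & Ce & He) (f & Cf & Hf)].
    apply (comp_realizer HA (lam K (tCase K (tFst K (Var 0))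
      (App (Cst e) (tSnd K (Var 1))) (App (Cst f) (tSnd K (Var 1)))))); [const_comp|].
    apply wp_lam. intros g Hg a [[|] p] (b & -> & Hb); apply Hg; wp.
    + left. split; [reflexivity|]. wp. apply He, Hb.
    + right. split; [reflexivity|]. wp. apply Hf, Hb.
Qed.

(** The pointwise [j p -> k p] has [p] on both sides and need not be monotone in it. Quantifying
    over all [q] that [p] maps into makes it so. *)
Definition arrow_op (j k : Omega A -> Omega A) (p : Omega A) : Omega A :=
  fun w => forall q h, imp p q h -> exists u, appl w h u /\ imp (j q) (k q) u.

Lemma arrow_is_LT (j k : Omega A -> Omega A) : is_LT j -> is_LT k -> is_LT (arrow_op j k).
Proof.
  intros [(mj & Cmj & Hmj) (uj & Cuj & Huj) (tj & Ctj & Htj)]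
         [(mk & Cmk & Hmk) (uk & Cuk & Huk) (tk & Ctk & Htk)].
  constructor.
  - apply (comp_realizer HA (lam K (lam K (lam K
      (App (Var 1) (lam K (App (Var 1) (App (Var 3) (Var 0))))))))); [const_comp|].
    apply wp_lam. intros e He p p' h Hh. apply He, wp_lam. intros f Hf w Hw.
    apply Hf, wp_lam. intros g Hg q h' Hh'. apply Hg. wp. apply wp_lam. intros c Hc.
    apply Hw. intros a Ha. apply Hc. wp.
    destruct (Hh a Ha) as (b & Hb & Hpb). exists b. split; [exact Hb|]. apply Hh', Hpb.
  - apply (comp_realizer HA (lam K (lam K (lam K
      (App (Cst uk) (App (Var 1) (Var 2))))))); [const_comp|].
    apply wp_lam. intros e He p a Ha. apply He, wp_lam. intros f Hf q h Hh.
    apply Hf, wp_lam. intros g Hg b _. apply Hg. wp.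
    destruct (Hh a Ha) as (c & Hc & Hqc). exists c. split; [exact Hc|]. apply Huk, Hqc.
  - (* [w] at [h' = (fun a' => a' h b)] has values in [k (k q)] *)
    apply (comp_realizer HA (lam K (lam K (lam K
      (App (Cst tk) (App (App (Var 2) (lam K (App (App (Var 0) (Var 2)) (Var 1))))
        (App (App (Cst mj) (Cst uk)) (Var 0)))))))); [const_comp|].
    apply wp_lam. intros e He p w Hw. apply He, wp_lam. intros f Hf q h Hh.
    apply Hf, wp_lam. intros g Hg b Hb. apply Hg. wp. apply wp_lam. intros c Hc.
    destruct (Hw (k q) c) as (u & Hu & Hu').
    { intros a' Ha'. apply Hc. wp. destruct (Ha' q h Hh) as (v & Hv & Hv').
      exists v. split; [exact Hv|]. apply Hv', Hb. }
    exists u. split; [exact Hu|].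
    destruct (Hmj q (k q) uk (Huk q)) as (v & Hv & Hv').
    exists v. split; [exact Hv|]. wp.
    destruct (Hv' b Hb) as (d & Hd & Hjd). exists d. split; [exact Hd|].
    destruct (Hu' d Hjd) as (d' & Hd' & Hkd). exists d'. split; [exact Hd'|].
    apply Htk, Hkd.
Qed.

Definition arrow_topology (j k : topology A) : topology A :=
  exist _ _ (arrow_is_LT _ _ (proj2_sig j) (proj2_sig k)).

(** From left to right, take [q] to be [p] with the identity map. From right to left, monotonicity
    of [i] carries a realizer of [i p] along [h] to one of [i q]. *)
Lemma arrow_topology_spec (i j k : topology A) :
  r_le A i (arrow_topology j k) <-> r_le A (meet_topology i j) k.
Proof.
  unfold r_le. cbn [proj1_sig meet_topology arrow_topology]. split; intros (e & Ce & He).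
  - apply (comp_realizer HA (lam K
      (App (App (App (Cst e) (tFst K (Var 0))) (lam K (Var 0))) (tSnd K (Var 0)))));
      [const_comp|].
    apply wp_lam. intros f Hf p x (a & b & -> & Ha & Hb). apply Hf. wp.
    destruct (He p a Ha) as (w & Hw & Hw'). exists w. split; [exact Hw|].
    apply wp_lam. intros c Hc.
    destruct (Hw' p c) as (u & Hu & Hu'); [intros y Hy; now apply Hc|].
    exists u. split; [exact Hu|]. wp. apply Hu', Hb.
  - destruct (LT_mono _ (proj2_sig i)) as (m & Cm & Hm).
    apply (comp_realizer HA (lam K (lam K (lam K (App (Cst e)
      (tPair K (App (App (Cst m) (Var 1)) (Var 2)) (Var 0))))))); [const_comp|].
    apply wp_lam. intros f Hf p a Ha. apply Hf, wp_lam. intros g Hg q h Hh.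
    apply Hg, wp_lam. intros c Hc b Hb. apply Hc. wp.
    destruct (Hm p q h Hh) as (mh & Hmh & Hmh'). exists mh. split; [exact Hmh|]. wp.
    destruct (Hmh' a Ha) as (d & Hd & Hid). exists d. split; [exact Hd|].
    apply He. exists d, b. auto.
Qed.
End Topologies.

(** * The game and the generated topology *)

(** Dependent choice with rules that see the whole past; it supplies Merlin's play. *)
Lemma history_dependent_sequence {T : Type} (R : list T -> T -> Prop) (t0 : T) :
  (forall l, exists t, R l t) ->
  exists m : nat -> T, m 0 = t0 /\ forall n, R (map m (seq 0 (S n))) (m (S n)).
Proof.
  intros H. destruct (choice R H) as [mu Hmu].
  set (hist := fix hist n := match n with
               | 0 => [t0] | S n' => hist n' ++ [mu (hist n')] end).
  set (m := fun n => match n with 0 => t0 | S n' => mu (hist n') end).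
  assert (E : forall n, map m (seq 0 (S n)) = hist n).
  { induction n as [|n IHn]; [reflexivity|].
    rewrite seq_S, map_app, IHn. reflexivity. }
  exists m. split; [reflexivity|]. intros n. rewrite E. apply Hmu.
Qed.

Lemma partial_function_of_relation {T U : Type} (R : T -> U -> Prop) :
  (forall x y y', R x y -> R x y' -> y = y') ->
  exists f : T -> option U, forall x y, f x = Some y <-> R x y.
Proof.
  intros HR. apply (choice (fun x o => forall y, o = Some y <-> R x y)). intros x.
  destruct (classic (exists y, R x y)) as [[y Hy]|Hno].
  - exists (Some y). intros y'. split; [now intros [= <-]|].
    intros Hy'. f_equal. eauto.
  - exists None. intros y. split; [discriminate|]. intros Hy. exfalso. eauto.
Qed.

Section GameTree.
Context {A : algebra} (HA : pca A) (K : combinators A).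
Context {L M : Type} (F : ext_pred A L) (G : ext_pred A M).

(* Positions are represented as difference lists, so that Merlin's next move is
   appended without a recursion. *)
Definition prepends (d : A) (l : list A) : Prop :=
  forall m, appl d (list_code m) (list_code (l ++ m)).

(* The part of the strategy [tau] from a position on, as a tree. *)
Definition unfolds (tau : @arthur_strategy A) (z : A) : Prop :=
  forall d l m, prepends d l -> tau l = Some m ->
  match m with
  | (Halt, q) => appl z d (npair (num 1) q)
  | (Query, q) => exists f, appl z d (npair (num 0) (npair q f)) /\
      forall p (R : A -> Prop), (forall d', prepends d' (l ++ [p]) -> exists b, appl z d' b /\ R b) ->
        exists b, appl f p b /\ R b
  end.

Lemma unfolding_exists (tau : @arthur_strategy A) : computable_strategy tau ->
  exists e z, comp e /\ unfolds tau z /\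
    forall p (R : A -> Prop),
      (forall d, prepends d [p] -> exists b, appl z d b /\ R b) ->
      exists b, appl e p b /\ R b.
Proof.
  intros (t & Ct & Ht). destruct (fixpoint_combinator HA K) as (y & Cy & Hy).
  (* The arguments of [extend] are read under its binder. Hence [Var 4] below is the recursive
     function where it is applied, but the difference list inside [extend]. *)
  set (extend := fun d p : term => lam K (App d (tPair K (Cst (num 1)) (tPair K p (Var 0))))
    : term (A := A)).
  (* A halting move is already the code of a leaf and is returned as it is; a query only acquires
     its continuation. *)
  set (branch := tCase K (tFst K (Var 0))
      (tPair K (Cst (num 0)) (tPair K (tSnd K (Var 1))
         (lam K (App (Var 4) (extend (Var 4) (Var 1))))))
      (Var 1) : term (A := A)).
  assert (Hz : exists z, comp z /\ unfolds tau z).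
  { apply (comp_realizer HA (tFix K y (App (lam K branch)
      (App (Cst t) (App (Var 0) (tPair K (Cst (num 0)) (Cst (num 0)))))))).
    { unfold branch, extend. const_comp. }
    apply wp_fix; [exact Hy|]. intros z Hz d l [a q] Hd Hm.
    assert (Hbranch : forall R : A -> Prop,
      wp (scons (move_code (a, q)) (scons d (scons z (fun _ => num 0)))) branch R ->
      exists b, appl z d b /\ R b).
    { intros R HR. apply Hz. wp. apply wp_lam. intros g Hg. wp.
      exists (list_code l). split; [specialize (Hd []); now rewrite app_nil_r in Hd|].
      exists (move_code (a, q)). split; [exact (Ht l _ Hm)|]. apply Hg, HR. }
    unfold branch in Hbranch. destruct a; cbn [move_code] in Hbranch.
    - destruct (Hbranch (fun b => exists f, b = npair (num 0) (npair q f) /\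
        forall p (R : A -> Prop),
          (forall d', prepends d' (l ++ [p]) -> exists b, appl z d' b /\ R b) ->
          exists b, appl f p b /\ R b)) as (b & Hb & f & -> & Hf); [|eauto].
      wp. left. split; [reflexivity|]. wp. apply wp_lam. intros f Hf. exists f.
      split; [reflexivity|]. intros p R HR. apply Hf. wp. apply wp_lam. intros d' Hd'.
      apply HR. intros m.
      destruct (Hd' (list_code m) (fun b => b = list_code ((l ++ [p]) ++ m)))
        as (b & Hb' & ->); [|exact Hb'].
      wp. eexists. split; [apply (Hd (p :: m))|]. now rewrite <- app_assoc.
    - destruct (Hbranch (fun b => b = npair (num 1) q)) as (b & Hb & ->); [|exact Hb].
      wp. right. split; [reflexivity|]. wp. reflexivity. }
  destruct Hz as (z & Cz & Hz).
  enough (He : exists e, comp e /\ forall p (R : A -> Prop),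
      (forall d, prepends d [p] -> exists b, appl z d b /\ R b) ->
      exists b, appl e p b /\ R b) by (destruct He as (e & Ce & He); eauto).
  apply (comp_realizer HA (lam K (App (Cst z)
    (lam K (tPair K (Cst (num 1)) (tPair K (Var 1) (Var 0))))))); [const_comp|].
  apply wp_lam. intros e He p R HR. apply He. wp. apply wp_lam. intros d Hd.
  apply HR. intros m.
  destruct (Hd (list_code m) (fun b => b = list_code ([p] ++ m))) as (b & Hb & ->);
    [|exact Hb].
  wp. reflexivity.
Qed.

(* Otherwise Merlin could answer forever so that the unfolding of Arthur's
   strategy stays outside [tree G]. *)
Lemma winning_tree (tau : @arthur_strategy A) (eta : @nimue_strategy A L M) z p0 x0 :
  unfolds tau z -> winning F G tau eta -> ep_dom F p0 x0 ->
  forall d, prepends d [p0] -> exists b, appl z d b /\ tree G (ep_val F p0 x0) b.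
Proof.
  intros Hz Hwin Hdom.
  set (good := fun l => forall d, prepends d l ->
    exists b, appl z d b /\ tree G (ep_val F p0 x0) b).
  assert (good_halt : forall l q, tau l = Some (Halt, q) -> ep_val F p0 x0 q -> good l).
  { intros l q Hq Hv d Hd. exists (npair (num 1) q).
    split; [apply (Hz d l _ Hd Hq)|now apply tree_halt]. }
  assert (good_query : forall l q x, tau l = Some (Query, q) -> ep_dom G q x ->
    (forall p, ep_val G q x p -> good (l ++ [p])) -> good l).
  { intros l q x Hq Hx Hl d Hd. destruct (Hz d l _ Hd Hq) as (f & Hf & Hf').
    exists (npair (num 0) (npair q f)). split; [exact Hf|].
    apply (tree_ask HA G _ q x f Hx). intros p Hp. apply Hf'. exact (Hl p Hp). }
  change (good [p0]). apply NNPP. intros Hbad.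
  (* Nimue's input contains Arthur's queries, which [tau] determines from Merlin's moves; [p0] is a
     default. *)
  set (query_of := fun l => match tau l with Some (_, q) => q | None => p0 end).
  set (history := fun l : list A =>
    map (fun i => (nth i l p0, query_of (firstn (S i) l))) (seq 0 (length l))).
  set (escapes := fun l p => exists q x, tau l = Some (Query, q)
    /\ eta x0 (history l) = Some x /\ ep_val G q x p /\ ~ good (l ++ [p])).
  (* Merlin escapes whenever he can and plays the default [p0] only where no answer escapes. *)
  destruct (history_dependent_sequence
    (fun l p => (exists p', escapes l p') -> escapes l p) p0) as (m & Hm0 & Hm).
  { intros l. destruct (classic (exists p', escapes l p')) as [[p' Hp']|Hno]; [eauto|].
    exists p0. intros Hp. contradiction. }
  set (pos := fun n => map m (seq 0 (S n))) in *.
  set (P := Play x0 m (fun n => tau (pos n)) (fun n => eta x0 (history (pos n)))).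
  assert (Hfollows : follows tau eta P).
  { intros n. split; [reflexivity|]. cbn [nimue arthur opening merlin P]. intros qs Hqs.
    f_equal. unfold history. change (pos n) with (map m (seq 0 (S n))) at 1.
    unfold pos at 2. rewrite length_map, length_seq. apply map_ext_in.
    intros i Hi%in_seq. f_equal.
    - unfold pos. rewrite <- Hm0, map_nth, seq_nth by lia. reflexivity.
    - replace (firstn (S i) (pos n)) with (pos i).
      + unfold query_of. destruct (Hqs i) as [a Ha]; [lia|]. now rewrite Ha.
      + unfold pos. replace (S n) with (S i + (n - i)) by lia.
        rewrite seq_app, map_app, firstn_app, length_map, length_seq, Nat.sub_diag.
        rewrite firstn_O, app_nil_r, firstn_all2; [reflexivity|].
        rewrite length_map, length_seq. lia. }
  (* If all legal answers led to good positions, [good_query] would make the present one good; so a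
     bad position with a legal query has an escape. *)
  assert (Hescape : forall n q x, legal_query G P n q x -> ~ good (pos n) ->
    ep_val G q x (m (S n)) /\ ~ good (pos (S n))).
  { intros n q x (Hq & Hx & Hdx) Hn. cbn [arthur nimue P] in Hq, Hx.
    destruct (Hm n) as (q' & x' & Hq' & Hx' & Hv & Hnext).
    - apply NNPP. intros Hno. apply Hn, (good_query _ q x Hq Hdx). intros p Hp.
      apply NNPP. intros Hgood. apply Hno. exists p, q, x. auto.
    - fold (pos n) in Hq', Hx', Hnext. rewrite Hq in Hq'. rewrite Hx in Hx'.
      injection Hq' as <-. injection Hx' as <-. split; [exact Hv|].
      unfold pos. now rewrite seq_S, map_app. }
  assert (Hpos : forall n, (forall i, i < n -> round_continues G P i) -> ~ good (pos n)).
  { induction n as [|n IHn]; intros Hn.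
    - unfold pos. cbn [seq map]. now rewrite Hm0.
    - destruct (Hn n (Nat.lt_succ_diag_r n)) as (q & x & Hl & _).
      apply (Hescape n q x Hl), IHn. auto with arith. }
  destruct (Hwin P Hfollows) as [Hno|(n & Hn & [(q & Hq & Hv)|(q & x & Hl & Hv)])].
  - apply Hno. cbn [merlin opening P]. now rewrite Hm0.
  - apply (Hpos n Hn). cbn [merlin opening arthur P] in Hq, Hv. rewrite Hm0 in Hv.
    exact (good_halt _ q Hq Hv).
  - apply Hv, (Hescape n q x Hl), Hpos, Hn.
Qed.

(* Nimue's moves after the opening, as a function of Merlin's later moves. *)
Inductive wins (p : Omega A) : (list A -> option M) -> A -> Prop :=
| wins_halt nu a : p a -> wins p nu (npair (num 1) a)
| wins_query nu q x f :
    nu [] = Some x -> ep_dom G q x ->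
    (forall b, ep_val G q x b -> exists s, appl f b s) ->
    (forall b s, ep_val G q x b -> appl f b s -> wins p (fun h => nu (b :: h)) s) ->
    wins p nu (npair (num 0) (npair q f)).

(** [tree] asserts only that a point exists at each node; choice over Merlin's answers gathers these
    points into one function. *)
Lemma tree_wins (p : Omega A) s : tree G p s -> exists nu, wins p nu s.
Proof.
  induction 1 as [a Ha|q x f Hx Hdef Hs IH].
  - exists (fun _ => None). now apply wins_halt.
  - destruct (choice (fun b nu => forall s, ep_val G q x b -> appl f b s -> wins p nu s))
      as [nu Hnu].
    { intros b. destruct (classic (ep_val G q x b)) as [Hb|Hb].
      - destruct (Hdef b Hb) as [s Hfs]. destruct (IH b s Hb Hfs) as [nu Hnu].
        exists nu. intros s' _ Hs'. now rewrite (appl_fun A HA _ _ _ _ Hs' Hfs).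
      - exists (fun _ => None). contradiction. }
    exists (fun h => match h with [] => Some x | b :: h' => nu b h' end).
    apply (wins_query p _ q x f); auto.
Qed.

(** * Arthur's strategy read off a realizer *)

Fixpoint steps (s : A) (l : list A) (s' : A) : Prop :=
  match l with
  | [] => s = s'
  | b :: l' => exists q f t, s = npair (num 0) (npair q f) /\ appl f b t /\ steps t l' s'
  end.

Lemma steps_snoc s l q f b t :
  steps s l (npair (num 0) (npair q f)) -> appl f b t -> steps s (l ++ [b]) t.
Proof.
  revert s. induction l as [|c l IHl]; cbn [steps app]; intros s Hs Ht.
  - exists q, f, t. auto.
  - destruct Hs as (q' & f' & t' & -> & Ht' & Hs). exists q', f', t'. auto.
Qed.

Definition outputs (s : A) (m : action * A) : Prop :=
  match m with
  | (Halt, a) => s = npair (num 1) a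
  | (Query, q) => exists f, s = npair (num 0) (npair q f)
  end.

(** Stated as a relation because the applications may be undefined once Merlin leaves the rules. *)
Definition plays (e : A) (l : list A) (m : action * A) : Prop :=
  match l with
  | [] => False
  | p :: l' => exists s s', appl e p s /\ steps s l' s' /\ outputs s' m
  end.

Lemma steps_fun s l s1 s2 : steps s l s1 -> steps s l s2 -> s1 = s2.
Proof.
  revert s. induction l as [|b l IHl]; cbn [steps]; intros s H1 H2; [congruence|].
  destruct H1 as (q & f & t & E & Ht & H1), H2 as (q' & f' & t' & E' & Ht' & H2).
  rewrite E in E'. apply (npair_inj HA K) in E' as [_ E'].
  apply (npair_inj HA K) in E' as [_ <-].
  rewrite (appl_fun A HA _ _ _ _ Ht' Ht) in H2. eauto.
Qed.

Lemma outputs_fun s m m' : outputs s m -> outputs s m' -> m = m'.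
Proof.
  pose proof (num_neq A HA) as Hn.
  destruct m as [[] a], m' as [[] a']; cbn [outputs].
  - intros [f ->] [f' E]. apply (npair_inj HA K) in E as [_ E].
    now apply (npair_inj HA K) in E as [<- _].
  - intros [f ->] E. apply (npair_inj HA K) in E as [E _]. contradiction.
  - intros -> [f E]. apply (npair_inj HA K) in E as [E _]. now symmetry in E.
  - intros -> E. now apply (npair_inj HA K) in E as [_ <-].
Qed.

Lemma plays_fun e l m m' : plays e l m -> plays e l m' -> m = m'.
Proof.
  destruct l as [|p l]; cbn [plays]; [contradiction|].
  intros (s & s' & Hs & Hs' & Ho) (t & t' & Ht & Ht' & Ho').
  rewrite (appl_fun A HA _ _ _ _ Ht Hs) in Ht'. rewrite (steps_fun _ _ _ _ Ht' Hs') in Ho'.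
  exact (outputs_fun s' m m' Ho Ho').
Qed.

Lemma plays_computable e : comp e ->
  exists t, comp t /\ forall l m, plays e l m -> appl t (list_code l) (move_code m).
Proof.
  intros Ce. destruct (fixpoint_combinator HA K) as (y & Cy & Hy).
  (* The input is a node paired with the remaining answers. The outer case asks whether answers
     remain, the inner one whether the node is a leaf. *)
  set (run := tCase K (tFst K (tSnd K (Var 0)))
    (tCase K (tFst K (tFst K (Var 1)))
      (tPair K (Cst (num 0)) (tFst K (tSnd K (tFst K (Var 2)))))
      (tFst K (Var 2)))
    (App (Var 2) (tPair K
      (App (tSnd K (tSnd K (tFst K (Var 1)))) (tFst K (tSnd K (tSnd K (Var 1)))))
      (tSnd K (tSnd K (tSnd K (Var 1)))))) : term (A := A)).
  assert (Hrun : exists r, comp r /\ forall s l s' m, steps s l s' -> outputs s' m ->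
    exists b, appl r (npair s (list_code l)) b /\ b = move_code m).
  { apply (comp_realizer HA (tFix K y run)); [unfold run; const_comp|].
    apply wp_fix; [exact Hy|]. intros r Hr s l s' m Hs Ho. revert s Hs. unfold run in Hr.
    induction l as [|b l IHl]; intros s Hs; apply Hr; cbn [list_code]; wp.
    - left. split; [reflexivity|]. cbn [steps] in Hs. subst s'.
      destruct m as [[] a]; cbn [outputs] in Ho.
      + destruct Ho as [f ->]. wp. left. split; [reflexivity|]. wp. reflexivity.
      + subst s. wp. right. split; [reflexivity|]. wp. reflexivity.
    - right. split; [reflexivity|]. destruct Hs as (q & f & t & -> & Ht & Hs). wp.
      exists t. split; [exact Ht|]. wp. exact (IHl t Hs). }
  destruct Hrun as (r & Cr & Hr).
  apply (comp_realizer HA (lam K (App (Cst r) (tPair K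
    (App (Cst e) (tFst K (tSnd K (Var 0)))) (tSnd K (tSnd K (Var 0))))))); [const_comp|].
  apply wp_lam. intros t Ht [|p l] m; cbn [plays]; [contradiction|].
  intros (s & s' & Hs & Hs' & Ho).
  destruct (Ht (list_code (p :: l)) (fun b => b = move_code m)) as (b & Hb & ->); [|exact Hb].
  cbn [list_code]. wp. exists s. split; [exact Hs|]. wp. exact (Hr s l s' m Hs' Ho).
Qed.

Lemma LT_le_solves : LT_le F G <-> exists e, comp e /\ solves F (tree G) e.
Proof.
  split.
  - intros (tau & eta & Htau & Hwin).
    destruct (unfolding_exists tau Htau) as (e & z & Ce & Hz & He).
    exists e. split; [exact Ce|]. intros p0 x0 Hdom. apply He.
    exact (winning_tree tau eta z p0 x0 Hz Hwin Hdom).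
  - intros (e & Ce & He).
    destruct (partial_function_of_relation (plays e) (plays_fun e)) as [tau Htau].
    destruct (choice (fun (px : A * L) nu => ep_dom F (fst px) (snd px) ->
      forall s, appl e (fst px) s -> wins (ep_val F (fst px) (snd px)) nu s)) as [nu Hnu].
    { intros [p x]. cbn [fst snd]. destruct (classic (ep_dom F p x)) as [Hdom|Hdom].
      - destruct (He p x Hdom) as (s & Hs & Ht). destruct (tree_wins _ _ Ht) as [nu Hnu].
        exists nu. intros _ s' Hs'. now rewrite (appl_fun A HA _ _ _ _ Hs' Hs).
      - exists (fun _ => None). contradiction. }
    (* Nimue ignores Arthur's queries, since they are determined by Merlin's moves. *)
    exists tau, (fun x h => match h with
                  | [] => None
                  | (p, _) :: h' => nu (p, x) (map fst h')
                  end).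
    split.
    { destruct (plays_computable e Ce) as (t & Ct & Ht). exists t. split; [exact Ct|].
      intros l m Hm. apply Ht, Htau, Hm. }
    intros P HP.
    destruct (classic (ep_dom F (merlin P 0) (opening P))) as [Hdom|Hdom]; [|now left].
    destruct (He _ _ Hdom) as (s0 & Hs0 & _).
    pose proof (Hnu (merlin P 0, opening P) Hdom s0 Hs0) as Hw. cbn [fst snd] in Hw.
    set (nu0 := nu (merlin P 0, opening P)) in Hw.
    (* The induction follows the play: [s] is the node reached after [n] answers, and [nu'] is what
       remains of Nimue's strategy there. *)
    enough (H : forall nu' s, wins (ep_val F (merlin P 0) (opening P)) nu' s -> forall n,
      (forall i, i < n -> round_continues G P i) ->
      steps s0 (map (merlin P) (seq 1 n)) s ->
      (forall h, nu' h = nu0 (map (merlin P) (seq 1 n) ++ h)) -> won F G P).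
    { apply (H nu0 s0 Hw 0); [lia|reflexivity|reflexivity]. }
    clear Hw. intros nu' s Hw.
    induction Hw as [nu' a Ha|nu' q x f Hx Hdx Hdef Hs IH]; intros n Hn Hsteps Hnu'.
    + right. exists n. split; [exact Hn|]. left. exists a. split; [|exact Ha].
      rewrite (proj1 (HP n)). apply Htau. exists s0. eexists.
      split; [exact Hs0|]. split; [exact Hsteps|]. reflexivity.
    + assert (Hq : arthur P n = Some (Query, q)).
      { rewrite (proj1 (HP n)). apply Htau. exists s0. eexists.
        split; [exact Hs0|]. split; [exact Hsteps|]. now exists f. }
      assert (Hl : legal_query G P n q x).
      { split; [exact Hq|]. split; [|exact Hdx].
        rewrite (proj2 (HP n) (fun i => match arthur P i with Some (_, q) => q | None => q end)).
        - cbn [seq map]. rewrite map_map. cbn [fst]. fold nu0.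
          rewrite <- (app_nil_r (map _ _)), <- Hnu'. exact Hx.
        - intros i Hi. destruct (Nat.eq_dec i n) as [->|Hne].
          + rewrite Hq. eauto.
          + destruct (Hn i ltac:(lia)) as (q' & x' & (Hq' & _) & _). rewrite Hq'. eauto. }
      destruct (classic (ep_val G q x (merlin P (S n)))) as [Hv|Hv].
      * destruct (Hdef _ Hv) as [t Ht]. apply (IH _ t Hv Ht (S n)).
        -- intros i Hi. destruct (Nat.eq_dec i n) as [->|Hne]; [|apply Hn; lia].
           exists q, x. auto.
        -- rewrite seq_S, map_app. exact (steps_snoc _ _ _ _ _ _ Hsteps Ht).
        -- intros h. rewrite Hnu', seq_S, map_app, <- app_assoc. reflexivity.
      * right. exists n. split; [exact Hn|]. right. exists q, x. auto.
Qed.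
End GameTree.

(** * Degrees *)

Lemma degree_ext {T : Type} (le : T -> T -> Prop) (C D : degree le) :
  (forall x, proj1_sig C x <-> proj1_sig D x) -> C = D.
Proof.
  destruct C as [C HC], D as [D HD]. cbn [proj1_sig]. intros H.
  assert (C = D) as <-.
  { apply functional_extensionality. intros x. apply propositional_extensionality, H. }
  f_equal. apply proof_irrelevance.
Qed.

Definition degree_of {T : Type} (le : T -> T -> Prop) (x : T) : degree le :=
  exist _ (fun y => le x y /\ le y x) (ex_intro _ x (fun y => iff_refl _)).

Section Preorders.
Context {T : Type} (le : T -> T -> Prop).
Context (le_refl : forall x, le x x) (le_trans : forall x y z, le x y -> le y z -> le x z).

Lemma degree_inhabited (C : degree le) : exists x, proj1_sig C x.
Proof. destruct C as [C [x Hx]]. exists x. now apply Hx. Qed.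

Lemma degree_eq (C : degree le) x y : proj1_sig C x -> (proj1_sig C y <-> le x y /\ le y x).
Proof. destruct C as [C [r Hr]]. cbn [proj1_sig]. rewrite !Hr. intuition eauto. Qed.

Lemma degree_le_iff (C D : degree le) x y :
  proj1_sig C x -> proj1_sig D y -> (degree_le le C D <-> le x y).
Proof.
  intros Hx Hy. split; [|intros H; exists x, y; auto].
  intros (x' & y' & Hx' & Hy' & H).
  apply (degree_eq C x x' Hx) in Hx' as [Hx' _]. apply (degree_eq D y y' Hy) in Hy' as [_ Hy'].
  eauto.
Qed.

Lemma degree_of_le x y : degree_le le (degree_of le x) (degree_of le y) <-> le x y.
Proof. apply degree_le_iff; cbn; auto. Qed.

Lemma degree_order : order (degree le) (degree_le le).
Proof.
  constructor.
  - intros C. destruct (degree_inhabited C) as [x Hx]. exists x, x. auto.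
  - intros C D E. destruct (degree_inhabited C) as [x Hx], (degree_inhabited D) as [y Hy],
      (degree_inhabited E) as [z Hz].
    rewrite (degree_le_iff C D x y), (degree_le_iff D E y z), (degree_le_iff C E x z); eauto.
  - intros C D. destruct (degree_inhabited C) as [x Hx], (degree_inhabited D) as [y Hy].
    rewrite (degree_le_iff C D x y), (degree_le_iff D C y x) by assumption.
    intros Hxy Hyx. apply degree_ext. intros z.
    rewrite (degree_eq C x z Hx), (degree_eq D y z Hy). intuition eauto.
Qed.
End Preorders.

(** The premise on implication names just one meet of [z] and [x], because meets are unique in the
    antisymmetric order [leD]. *)
Lemma heyting_of_surjection {T D : Type} (leT : T -> T -> Prop) (leD : D -> D -> Prop)
    (Q : T -> D) :
  order D leD -> (forall x y, leT x y <-> leD (Q x) (Q y)) ->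
  (forall d, exists x, Q x = d) ->
  (exists b, forall x, leT b x) -> (exists t, forall x, leT x t) ->
  (forall x y, exists m, is_meet leT x y m) -> (forall x y, exists s, is_join leT x y s) ->
  (forall x y, exists i, forall z, exists m, is_meet leT z x m /\ (leT z i <-> leT m y)) ->
  is_heyting leD.
Proof.
  intros Hord HQ Hsurj [b Hb] [t Ht] Hmeet Hjoin Himp.
  constructor; [exact Hord|..].
  - exists (Q b). intros d. destruct (Hsurj d) as [x <-]. now apply HQ.
  - exists (Q t). intros d. destruct (Hsurj d) as [x <-]. now apply HQ.
  - intros d e. destruct (Hsurj d) as [x <-], (Hsurj e) as [y <-].
    destruct (Hmeet x y) as [m Hm]. exists (Q m). intros c. destruct (Hsurj c) as [z <-].
    rewrite <- !HQ. apply Hm.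
  - intros d e. destruct (Hsurj d) as [x <-], (Hsurj e) as [y <-].
    destruct (Hjoin x y) as [s Hs]. exists (Q s). intros c. destruct (Hsurj c) as [z <-].
    rewrite <- !HQ. apply Hs.
  - intros d e. destruct (Hsurj d) as [x <-], (Hsurj e) as [y <-].
    destruct (Himp x y) as [i Hi]. exists (Q i). intros c m' Hm'.
    destruct (Hsurj c) as [z <-]. destruct (Hi z) as (m & Hm & Hiff).
    rewrite <- HQ, Hiff, HQ.
    assert (m' = Q m) as ->; [|reflexivity].
    apply (ord_antisym _ _ Hord).
    + destruct (Hsurj m') as [n <-]. apply HQ, Hm.
      rewrite !HQ. apply Hm', (ord_refl _ _ Hord).
    + apply Hm'. rewrite <- !HQ. apply Hm, HQ, (ord_refl _ _ Hord).
Qed.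

Section Equivalence.
Context {S T : Type} (leS : S -> S -> Prop) (leT : T -> T -> Prop).
Context (reflT : forall t, leT t t) (transT : forall t u v, leT t u -> leT u v -> leT t v).
Context (f : S -> T) (g : T -> S).
Context (f_le : forall x y, leS x y <-> leT (f x) (f y)).
Context (fg : forall t, leT (f (g t)) t /\ leT t (f (g t))).

Lemma source_refl x : leS x x.
Proof. apply f_le, reflT. Qed.

Lemma source_trans x y z : leS x y -> leS y z -> leS x z.
Proof. rewrite !f_le. eauto. Qed.

Lemma g_le t u : leT t u <-> leS (g t) (g u).
Proof.
  rewrite f_le. destruct (fg t) as [Ht Ht'], (fg u) as [Hu Hu']. split; eauto.
Qed.

Lemma gf x : leS (g (f x)) x /\ leS x (g (f x)).
Proof. rewrite !f_le. apply fg. Qed.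

Lemma degree_of_g_le t u :
  leT t u <-> degree_le leS (degree_of leS (g t)) (degree_of leS (g u)).
Proof.
  rewrite g_le. symmetry. apply (degree_of_le leS source_refl source_trans).
Qed.

Lemma degree_of_g_surj (C : degree leS) : exists t, degree_of leS (g t) = C.
Proof.
  destruct (degree_inhabited leS source_refl C) as [x Hx]. exists (f x).
  apply degree_ext. intros y. cbn [proj1_sig degree_of].
  rewrite (degree_eq leS source_trans C x y Hx). destruct (gf x) as [H1 H2].
  split; intros [H H']; split; eauto using source_trans.
Qed.

(** The bijection sends [C] to the degree of some [t] for which [g t] represents [C]; this is
    unambiguous because [g] reflects the order. *)
Lemma degrees_isomorphic : order_isomorphic (degree_le leS) (degree_le leT).
Proof.
  destruct (choice (fun (C : degree leS) t => degree_of leS (g t) = C) degree_of_g_surj)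
    as [r Hr].
  exists (fun C => degree_of leT (r C)).
  assert (Hrg : forall t, leT (r (degree_of leS (g t))) t /\ leT t (r (degree_of leS (g t)))).
  { intros t. rewrite !degree_of_g_le, Hr.
    split; apply (ord_refl _ _ (degree_order leS source_refl source_trans)). }
  split.
  - destruct (choice (fun (D : degree leT) t => degree_of leT t = D)) as [q Hq].
    { intros D. destruct (degree_inhabited leT reflT D) as [t Ht]. exists t.
      apply degree_ext. intros u. symmetry. exact (degree_eq leT transT D t u Ht). }
    assert (Hqd : forall t, leT (q (degree_of leT t)) t /\ leT t (q (degree_of leT t))).
    { intros t. enough (H : proj1_sig (degree_of leT t) (q (degree_of leT t)))
        by (destruct H; auto).
      rewrite <- Hq at 1. cbn. auto. }
    exists (fun D => degree_of leS (g (q D))). split.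
    + intros C. transitivity (degree_of leS (g (r C))); [|apply Hr].
      apply (ord_antisym _ _ (degree_order leS source_refl source_trans));
        apply degree_of_g_le, Hqd.
    + intros D. transitivity (degree_of leT (q D)); [|apply Hq].
      apply (ord_antisym _ _ (degree_order leT reflT transT));
        apply (degree_of_le leT reflT transT), Hrg.
  - intros C D. rewrite <- (Hr C), <- (Hr D) at 1. rewrite <- degree_of_g_le. symmetry.
    apply (degree_of_le leT reflT transT).
Qed.
End Equivalence.

(** * From topologies to problems *)

Section Problems.
Context {A : algebra} (HA : pca A) (K : combinators A).

Definition problem_topology (f : problem A) : topology A :=
  tree_topology HA K (theta (the_map f)).

Lemma TW_le_r_le (f g : problem A) :
  TW_le A f g <-> r_le A (problem_topology f) (problem_topology g).
Proof.
  unfold TW_le, problem_topology. rewrite (LT_le_solves HA K).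
  symmetry. apply (tree_universal HA K).
Qed.

(* The problem "given a realizer of [j p], find one of [p]", in which [p] is
   only known to Nimue and Merlin. *)
Definition topology_source (j : Omega A -> Omega A) : mrspace A :=
  MRSpace A { p : Omega A | exists a, j p a } (fun a p => j (proj1_sig p) a) (@proj2_sig _ _).

Definition carrier_space : mrspace A :=
  MRSpace A A eq (fun a => ex_intro _ a eq_refl).

Definition topology_problem (j : topology A) : problem A :=
  Problem A (topology_source (proj1_sig j)) carrier_space
    (Multimap A _ _ (fun _ => True)
       (fun (p : topology_source (proj1_sig j)) (b : carrier_space) => proj1_sig p b)).

(** The identity solves the problem in [j], which gives the first inequality. Conversely a realizer
    of [j p] is itself an instance of the problem, and the generated topology solves all
    instances. *)
Lemma problem_topology_problem (j : topology A) :
  r_le A (problem_topology (topology_problem j)) j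
  /\ r_le A j (problem_topology (topology_problem j)).
Proof.
  assert (E : forall a p, ep_val (theta (the_map (topology_problem j))) a p = proj1_sig p).
  { intros a p. apply functional_extensionality. intros b.
    apply propositional_extensionality. cbn. split; [|eauto].
    now intros (c & Hc & ->). }
  split.
  - apply (tree_universal HA K).
    apply (comp_realizer HA (lam K (Var 0))); [const_comp|].
    apply wp_lam. intros e He a p [Hp _]. rewrite E. now apply He.
  - destruct (proj1 (tree_universal HA K (theta (the_map (topology_problem j)))
      (problem_topology (topology_problem j))) (r_le_refl HA K _)) as (e & Ce & He).
    exists e. split; [exact Ce|]. intros p a Ha.
    specialize (He a (exist _ p (ex_intro _ a Ha))). rewrite E in He.
    apply He. now split.
Qed.
End Problems.

Theorem corollary5p33 (A : algebra) (hA : A = K1 \/ A = K2 \/ A = KV) :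
  is_heyting (degree_le (TW_le A))
  /\ order_isomorphic (degree_le (TW_le A)) (degree_le (r_le A)).
Proof.
  assert (HA : pca A).
  { destruct hA as [->|[->| ->]]; [apply K1_pca|apply K2_pca|apply KV_pca]. }
  destruct (combinators_exist A HA) as [K].
  pose proof (r_le_refl HA K) as Hrefl. pose proof (r_le_trans HA K) as Htrans.
  pose proof (TW_le_r_le HA K) as Hle.
  pose proof (problem_topology_problem HA K) as Heq.
  split.
  - apply (heyting_of_surjection (r_le A) (degree_le (TW_le A))
             (fun j => degree_of (TW_le A) (topology_problem j))).
    + apply degree_order; intros *; rewrite !Hle; eauto.
    + intros i j. exact (degree_of_g_le _ _ Hrefl Htrans _ _ Hle Heq i j).
    + exact (degree_of_g_surj _ _ Hrefl Htrans _ _ Hle Heq).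
    + apply (least_topology HA K).
    + apply (greatest_topology HA K).
    + intros j k. eexists. apply (meet_topology_spec HA K).
    + intros j k. eexists. apply (join_topology_spec HA K).
    + intros j k. exists (arrow_topology HA K j k). intros i.
      exists (meet_topology HA K i j). split; [apply meet_topology_spec|].
      apply arrow_topology_spec.
  - exact (degrees_isomorphic _ _ Hrefl Htrans _ _ Hle Heq).
Qed.
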